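(* Let $\Gamma$ be a non-abelian discrete group whose dual $\widehat\Gamma$ is total, and suppose $\widehat\Gamma\curvearrowright X$ for a finite graph $X$, with $\Gamma_u=\{g_1,\dots,g_k\}$ the set of elements of $\Gamma$ whose Fourier-type transitive magic representations appear in the fundamental magic representation, where $g_1,\dots,g_k$ have orders $N_1,\dots,N_k$. Then the dual of a free product acts on $X$: $$\widehat{\mathbb Z_{N_1}*\cdots*\mathbb Z_{N_k}}\curvearrowright X.$$ Therefore no finite non-abelian total group dual has the Frucht property.
   Context: For a finitely generated discrete group $\Gamma$, the dual $\widehat\Gamma$ is the compact quantum group with $C(\widehat\Gamma)=\mathrm{C}^*(\Gamma)$ (full group $\mathrm{C}^*$-algebra) and $\Delta(g)=g\otimes g$. A matrix over a $\mathrm{C}^*$-algebra is magic if its entries are projections summing to $1$ on each row and column. $G\subset S_N^+$ means that a fixed magic matrix $u\in M_N(C(G))$ is given whose entries generate $C(G)$ and satisfy $\Delta(u_{ij})=\sum_k u_{ik}\otimes u_{kj}$ (together with $\varepsilon(u_{ij})=\delta_{ij}$, $S(u_{ij})=u_{ji}$). $C(S_N^+)$ is the universal $\mathrm{C}^*$-algebra generated by the entries of an $N\times N$ magic matrix. For $g\in\Gamma$ of finite order $n$ and $w=e^{2\pi i/n}$, the Fourier-type transitive magic representation $u^g\in M_n(C(\widehat\Gamma))$ is $u^g_{kl}=\frac1n\sum_{m=1}^{n}w^{(k-l)m}g^m$. Two such representations $u^g,u^h$ are equivalent if $u^h=Pu^gP^{-1}$ for a permutation matrix $P$. For any embedding $\widehat\Gamma\subset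 S_N^+$, after relabelling $\{1,\dots,N\}$ the fundamental magic matrix is block diagonal with Fourier-type blocks, $u=\operatorname{diag}(u^{g_1},\dots,u^{g_1},\dots,u^{g_k},\dots,u^{g_k})$, with at most one representative from each equivalence class used (possibly with multiplicity); $\Gamma_u=\{g_1,\dots,g_k\}$ refers to such a labelling. The dual $\widehat\Gamma$ is total if for all $g_p,g_q\in\Gamma$ (of finite orders $N_p,N_q$), $1\le i,j\le N_p$, $1\le k,l\le N_q$: $u^{g_p}_{ij}u^{g_q}_{kl}=0$ implies that $u^{g_p},u^{g_q}$ are equivalent. A finite graph $X=(V,E)$, $|V|=N$, has $E$ symmetric and irreflexive, with adjacency matrix $d\in M_N(0,1)$. $G\curvearrowright X$ means that there is a fixed embedding $G\subset S_N^+$ with $du=ud$. $G^+(X)$ is given by $C(G^+(X))=C(S_N^+)/\langle du=ud\rangle$. $G$ has the Frucht property if there is a finite graph $X$ with $G=G^+(X)$ as abstract compact quantum groups.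
   Formalization: The last sentence is proved only for identifications of the dual with G^+(X) whose fundamental magic matrix has Fourier-type blocks after relabelling; embeddings with non-cyclic abelian blocks (e.g. Z_2×Z_2 on 4 points) are excluded, and with them it can fail. *)

(* Defs.v *)
From HB Require Import structures.
From mathcomp Require Import all_boot all_order all_algebra all_fingroup.
From mathcomp Require Import complex.
From mathcomp Require Import all_classical all_reals all_analysis.

Set Implicit Arguments.
Unset Strict Implicit.
Unset Printing Implicit Defensive.

Import Order.TTheory GRing.Theory Num.Theory.
Import numFieldNormedType.Exports.

Local Open Scope classical_set_scope.
Local Open Scope complex_scope.
Local Open Scope ring_scope.

(* ------------------------------------------------------------------------ *)
(* Unital C*-algebras over the complex numbers R[i].  An [algType] is        *)
(* nonzero, so the zero algebra is excluded.  The norm is real-valued and    *)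
(* the topology is spelled out through it: a join of the algebra and normed  *)
(* module hierarchies would conflict with their existing join at numeric     *)
(* domains.                                                                  *)
(* ------------------------------------------------------------------------ *)

HB.mixin Record isCStarAlgebra (R : realType) A & GRing.Algebra R[i] A := {
  star : A -> A ;
  cnorm : A -> R ;
  starK : involutive star ;
  starD : forall x y : A, star (x + y) = star x + star y ;
  starZ : forall (a : R[i]) (x : A), star (a *: x) = a^* *: star x ;
  starM : forall x y : A, star (x * y) = star y * star x ;
  cnorm_eq0 : forall x : A, cnorm x = 0 -> x = 0 ;
  cnormD : forall x y : A, cnorm (x + y) <= cnorm x + cnorm y ;
  cnormZ : forall (a : R[i]) (x : A),
    cnorm (a *: x) = Normc.normc a * cnorm x ;
  cnormM : forall x y : A, cnorm (x * y) <= cnorm x * cnorm y ;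
  cnorm_starM : forall x : A, cnorm (star x * x) = cnorm x ^+ 2 ;
  cnorm_complete : forall u : nat -> A,
    (forall e : R, 0 < e -> exists n0, forall m n, (n0 <= m)%N -> (n0 <= n)%N ->
       cnorm (u m - u n) < e) ->
    exists l : A, forall e : R, 0 < e -> exists n0, forall n, (n0 <= n)%N ->
       cnorm (u n - l) < e
}.

#[short(type="cstarType")]
HB.structure Definition CStarAlgebra (R : realType) :=
  {A of isCStarAlgebra R A & GRing.Algebra R[i] A}.

Section NormTopology.
Variables (R : realType) (A : cstarType R).

Definition cclosure (S : set A) : set A :=
  [set x | forall e : R, 0 < e -> exists2 y, S y & cnorm (x - y) < e].

Definition cclosed (S : set A) : Prop := cclosure S `<=` S.

Definition cdense (S : set A) : Prop := cclosure S = setT.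

End NormTopology.

(* *-homomorphisms are automatically contractive; this is recorded so that   *)
(* they are visibly continuous.                                              *)
Record starhom (R : realType) (A B : cstarType R) := StarHom {
  starhom_fun :> {lrmorphism A -> B} ;
  starhom_star : forall x, starhom_fun (star x) = star (starhom_fun x) ;
  starhom_contr : forall x, cnorm (starhom_fun x) <= cnorm x
}.

(* The C*-algebra of complex numbers. *)
Section ComplexCStar.
Variable R : realType.

Let conjZ (a : R[i]) (x : R[i]^o) : (a *: x : R[i])^* = a^* *: ((x : R[i])^* : R[i]^o).
Proof. by rewrite [LHS]rmorphM. Qed.

Let conjM (x y : R[i]^o) : ((x * y)^* : R[i]) = (y : R[i])^* * (x : R[i])^*.
Proof. by rewrite rmorphM mulrC. Qed.

Let normc_conj (x : R[i]) : Normc.normc (x^* * x) = Normc.normc x ^+ 2.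
Proof.
rewrite Normc.normcM expr2; congr (_ * _).
by case: x => a b; rewrite /= sqrrN.
Qed.

Let normc_leM (x y : R[i]) : Normc.normc (x * y) <= Normc.normc x * Normc.normc y.
Proof. by rewrite Normc.normcM. Qed.

Let le_Re (x : R[i]) : `|complex.Re x| <= Normc.normc x.
Proof. by case: x => a b /=; rewrite -sqrtr_sqr ler_wsqrtr // lerDl sqr_ge0. Qed.

Let le_Im (x : R[i]) : `|complex.Im x| <= Normc.normc x.
Proof. by case: x => a b /=; rewrite -sqrtr_sqr ler_wsqrtr // lerDr sqr_ge0. Qed.

Let normc_le (x : R[i]) : Normc.normc x <= `|complex.Re x| + `|complex.Im x|.
Proof.
case: x => a b /=; rewrite -[leRHS]ger0_norm ?addr_ge0 // -sqrtr_sqr.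
by rewrite ler_wsqrtr // sqrrD !real_normK ?num_real // addrAC lerDl mulrn_wge0 ?mulr_ge0.
Qed.

Let real_complete (u : nat -> R) :
  (forall e : R, 0 < e -> exists n0, forall m n, (n0 <= m)%N -> (n0 <= n)%N ->
     `|u m - u n| < e) ->
  exists l, forall e : R, 0 < e -> exists n0, forall n, (n0 <= n)%N -> `|u n - l| < e.
Proof.
move=> cu; have /cauchy_cvg/cvgrPdist_lt ul : cauchy (u @ \oo).
  apply: cauchy_exP => e e0; have [n0 un0] := cu e e0.
  by exists (u n0), n0 => // n /= n0n; exact: un0.
exists (lim (u @ \oo)) => e e0; have [n0 _ un0] := ul e e0.
by exists n0 => n n0n; rewrite distrC; exact: un0.
Qed.

Let complexC_complete (u : nat -> R[i]) :
  (forall e : R, 0 < e -> exists n0, forall m n, (n0 <= m)%N -> (n0 <= n)%N ->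
     Normc.normc (u m - u n) < e) ->
  exists l, forall e : R, 0 < e -> exists n0, forall n, (n0 <= n)%N ->
     Normc.normc (u n - l) < e.
Proof.
move=> cu.
have [e e0|a ua] := @real_complete (@complex.Re R \o u).
  have [n0 un0] := cu e e0; exists n0 => m n n0m n0n /=.
  by rewrite -raddfB; apply: le_lt_trans (un0 m n n0m n0n); exact: le_Re.
have [e e0|b ub] := @real_complete (@complex.Im R \o u).
  have [n0 un0] := cu e e0; exists n0 => m n n0m n0n /=.
  by rewrite -raddfB; apply: le_lt_trans (un0 m n n0m n0n); exact: le_Im.
exists (a +i* b) => e e0.
have e20 : 0 < e / 2 by rewrite divr_gt0.
have [n1 un1] := ua _ e20; have [n2 un2] := ub _ e20.
exists (maxn n1 n2) => n; rewrite geq_max => /andP[n1n n2n].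
apply: le_lt_trans (normc_le _) _; rewrite [ltRHS]splitr !raddfB /=.
by apply: ltrD; [exact: un1|exact: un2].
Qed.

HB.instance Definition _ := @isCStarAlgebra.Build R (R[i]^o)
  (fun x => (x : R[i])^*) (@Normc.normc R) (@conjCK _)
  (fun x y => rmorphD _ x y) conjZ conjM
  (@Normc.eq0_normc R) (@le_normcD R)
  (fun a x => Normc.normcM a x)
  normc_leM
  normc_conj complexC_complete.

End ComplexCStar.

Section LinearSpans.
Variables (K : nzRingType) (V : lmodType K).

Definition lin_free n (a : 'I_n -> V) : Prop :=
  forall c : 'I_n -> K, \sum_i c i *: a i = 0 -> forall i, c i = 0.

Definition lin_span (S : set V) : set V :=
  [set x | exists n (c : 'I_n -> K) (v : 'I_n -> V),
     (forall i, S (v i)) /\ x = \sum_i c i *: v i].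

End LinearSpans.

Section Subsets.
Variables (R : realType) (A : cstarType R).

Record cstar_subalg (S : set A) : Prop := {
  subalg_cclosed : cclosed S ;
  subalg1 : S 1 ;
  subalgD : forall x y, S x -> S y -> S (x + y) ;
  subalgZ : forall (a : R[i]) x, S x -> S (a *: x) ;
  subalgM : forall x y, S x -> S y -> S (x * y) ;
  subalg_star : forall x, S x -> S (star x)
}.

Definition cstar_generated (S : set A) : Prop :=
  forall B : set A, cstar_subalg B -> S `<=` B -> B = setT.

Record closed_ideal (I : set A) : Prop := {
  ideal_cclosed : cclosed I ;
  ideal0 : I 0 ;
  idealD : forall x y, I x -> I y -> I (x + y) ;
  idealMl : forall a x, I x -> I (a * x) ;
  idealMr : forall x a, I x -> I (x * a)
}.

Definition closed_ideal_gen (S : set A) : set A :=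
  [set x | forall I : set A, closed_ideal I -> S `<=` I -> I x].

End Subsets.

(* ------------------------------------------------------------------------ *)
(* Minimal tensor products: T, with legs a |-> a (x) 1 and b |-> 1 (x) b, is *)
(* a completion of the algebraic tensor product of A and B, and its norm is  *)
(* the least C*-norm.                                                        *)
(* ------------------------------------------------------------------------ *)

Section Tensor.
Variables (R : realType) (A B : cstarType R).

Definition elt_tensor (T : cstarType R) (i : starhom A T) (j : starhom B T)
    n (a : 'I_n -> A) (b : 'I_n -> B) : T := \sum_k i (a k) * j (b k).

Record tensor_completion (T : cstarType R)
    (i : starhom A T) (j : starhom B T) : Prop := {
  tensor_comm : forall a b, i a * j b = j b * i a ;
  (* the induced map from the algebraic tensor product is injective *)
  tensor_inj : forall n (a : 'I_n -> A) (b : 'I_n -> B),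
    lin_free a -> elt_tensor i j a b = 0 -> forall k, b k = 0 ;
  tensor_dense : cdense
    [set x | exists n (a : 'I_n -> A) (b : 'I_n -> B), x = elt_tensor i j a b]
}.

Definition min_tensor (T : cstarType R) (i : starhom A T) (j : starhom B T) :=
  tensor_completion i j /\
  forall (T' : cstarType R) (i' : starhom A T') (j' : starhom B T'),
    tensor_completion i' j' ->
    forall n (a : 'I_n -> A) (b : 'I_n -> B),
      cnorm (elt_tensor i j a b) <= cnorm (elt_tensor i' j' a b).

End Tensor.

(* ------------------------------------------------------------------------ *)
(* Compact quantum groups (Woronowicz).                                      *)
(* ------------------------------------------------------------------------ *)

(* T3 is (A (x) A) (x) A; D1, D2 and r are Delta (x) id, id (x) Delta and    *)
(* x |-> 1 (x) x.                                                            *)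
Definition coassociative (R : realType) (A T : cstarType R)
    (i j : starhom A T) (Delta : starhom A T) : Prop :=
  exists (T3 : cstarType R) (p : starhom T T3) (q : starhom A T3)
         (D1 D2 r : starhom T T3),
    [/\ min_tensor p q,
        forall a, D1 (i a) = p (Delta a) /\ D1 (j a) = q a,
        forall a, r (i a) = p (j a) /\ r (j a) = q a,
        forall a, D2 (i a) = p (i a) /\ D2 (j a) = r (Delta a) &
        forall a, D1 (Delta a) = D2 (Delta a)].

Record cqg (R : realType) := CQG {
  cqg_alg :> cstarType R ;
  cqg_sq : cstarType R ;
  legl : starhom cqg_alg cqg_sq ;
  legr : starhom cqg_alg cqg_sq ;
  cqg_tensor : min_tensor legl legr ;
  comult : starhom cqg_alg cqg_sq ;
  comultA : coassociative legl legr comult ;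
  cancell : cdense (lin_span
    [set x : cqg_sq | exists a b, x = legl a * comult b]) ;
  cancelr : cdense (lin_span
    [set x : cqg_sq | exists a b, x = legr a * comult b])
}.

(* phi2 is phi (x) phi. *)
Definition cqg_iso (R : realType) (G H : cqg R) (phi : starhom G H) : Prop :=
  bijective phi /\
  exists phi2 : starhom (cqg_sq G) (cqg_sq H),
    (forall a, phi2 (legl G a) = legl H (phi a)) /\
    (forall a, phi2 (legr G a) = legr H (phi a)) /\
    (forall a, comult H (phi a) = phi2 (comult G a)).

(* ------------------------------------------------------------------------ *)
(* Magic matrices and quantum permutation groups.                            *)
(* ------------------------------------------------------------------------ *)

Section Magic.
Variables (R : realType) (N : nat).

Record magic (A : cstarType R) (u : 'M[A]_N) : Prop := {
  magic_idem : forall i j, u i j * u i j = u i j ;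
  magic_star : forall i j, star (u i j) = u i j ;
  magic_row : forall i, \sum_j u i j = 1 ;
  magic_col : forall j, \sum_i u i j = 1
}.

Definition entries (A : cstarType R) (u : 'M[A]_N) : set A :=
  [set x | exists i j, x = u i j].

Definition comult_magic (G : cqg R) (u : 'M[G]_N) : Prop :=
  forall i j, comult G (u i j) = \sum_k legl G (u i k) * legr G (u k j).

(* The formulas determine the counit and the antipode (a morphism to the     *)
(* opposite algebra), since the entries of u generate.                       *)
Record embedding (G : cqg R) (u : 'M[G]_N) : Prop := {
  embedding_magic : magic u ;
  embedding_gen : cstar_generated (entries u) ;
  embedding_comult : comult_magic u ;
  embedding_counit : exists eps : starhom G R[i]^o,
    forall i j, eps (u i j) = (i == j)%:R ;
  embedding_antipode : exists S : {linear G -> G},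
    [/\ S 1 = 1 /\ (forall x y : G, S (x * y) = S y * S x),
        forall x, S (star x) = star (S x),
        forall x, cnorm (S x) <= cnorm x &
        forall i j, S (u i j) = u j i]
}.

(* A = C(S_N^+), with u its fundamental magic matrix. *)
Definition universal_magic (A : cstarType R) (u : 'M[A]_N) : Prop :=
  [/\ magic u, cstar_generated (entries u) &
      forall (B : cstarType R) (v : 'M[B]_N), magic v ->
        exists f : starhom A B, forall i j, f (u i j) = v i j].

Record graph := Graph {
  edge :> rel 'I_N ;
  edge_sym : symmetric edge ;
  edge_irr : irreflexive edge
}.

Definition adjacency (A : cstarType R) (X : graph) : 'M[A]_N :=
  \matrix_(i, j) (X i j)%:R.

(* u defines an action on X of G, a quantum subgroup of S_N^+ through u. *)
Definition acts (G : cqg R) (X : graph) (u : 'M[G]_N) : Prop :=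
  embedding u /\ adjacency G X *m u = u *m adjacency G X.

(* Q = G^+(X): C(Q) is the quotient of C(S_N^+) by the relations du = ud,    *)
(* and w is the image of the fundamental magic matrix.                       *)
Definition quantum_aut (X : graph) (Q : cqg R) (w : 'M[Q]_N) : Prop :=
  exists (S : cstarType R) (u : 'M[S]_N) (q : starhom S Q),
    [/\ universal_magic u,
        forall y, exists x, q x = y,
        forall x, q x = 0 <->
          closed_ideal_gen
            (entries (adjacency S X *m u - u *m adjacency S X)) x,
        w = map_mx q u &
        comult_magic w].

End Magic.

(* The Frucht property of G: G is isomorphic, as an abstract compact quantum *)
(* group, to some G^+(X).  The predicate std is the standard form that a     *)
(* class of quantum groups imposes on the fundamental magic matrices of its  *)
(* embeddings in S_N^+, here on the one which comes from G = G^+(X).  For    *)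
(* duals of discrete groups it is [fourier_type] below; it cannot be left    *)
(* out, since the dual of a finite abelian group which is not cyclic acts    *)
(* transitively on its points by a magic matrix of no Fourier type.          *)
Definition frucht (R : realType) (G : cqg R)
    (std : forall N, 'M[G]_N -> Prop) : Prop :=
  exists (N : nat) (X : graph N) (Q : cqg R) (w : 'M[Q]_N) (phi : starhom Q G),
    [/\ quantum_aut X w, cqg_iso phi & std N (map_mx phi w)].

(* ------------------------------------------------------------------------ *)
(* Groups and group duals.                                                   *)
(* ------------------------------------------------------------------------ *)

Definition group_abelian (Gamma : groupType) : Prop :=
  forall x y : Gamma, (x * y = y * x)%g.

Definition has_order (Gamma : groupType) (g : Gamma) (n : nat) : Prop :=
  [/\ (0 < n)%N, (g ^+ n = 1)%g &
      forall m, (0 < m < n)%N -> (g ^+ m)%g <> 1%g].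

(* Z_n for n > 0: the multiplicative notation of the group structure carried *)
(* by ordinals is addition modulo n.                                         *)
Definition cyclic_grp (n : nat) : groupType := 'I_n.-1.+1.

Definition free_product k (K : 'I_k -> groupType) (F : groupType)
    (iota : forall p, {multiplicative K p -> F}) : Prop :=
  forall (H : groupType) (f : forall p, {multiplicative K p -> H}),
    (exists h : {multiplicative F -> H}, forall p x, h (iota p x) = f p x) /\
    (forall h h' : {multiplicative F -> H},
       (forall p x, h (iota p x) = f p x) ->
       (forall p x, h' (iota p x) = f p x) -> h =1 h').

Section GroupDual.
Variables (R : realType) (Gamma : groupType).

(* A is the full group C*-algebra of Gamma: a completion of the group        *)
(* algebra for a C*-norm (first five clauses), through which every unitary   *)
(* representation factors, that is, whose norm is the largest one.           *)
Record full_group_cstar (A : cstarType R) (gam : Gamma -> A) : Prop := {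
  gam1 : gam 1%g = 1 ;
  gamM : forall x y, gam (x * y)%g = gam x * gam y ;
  gam_star : forall x, star (gam x) = gam (x^-1)%g ;
  gam_free : forall n (x : 'I_n -> Gamma), injective x -> lin_free (gam \o x) ;
  gam_dense : cdense (lin_span (range gam)) ;
  gam_univ : forall (B : cstarType R) (rho : Gamma -> B),
    rho 1%g = 1 -> (forall x y, rho (x * y)%g = rho x * rho y) ->
    (forall x, star (rho x) = rho (x^-1)%g) ->
    exists f : starhom A B, forall x, f (gam x) = rho x
}.

(* G is the dual of Gamma. *)
Definition group_dual (G : cqg R) (gam : Gamma -> G) : Prop :=
  full_group_cstar gam /\
  forall g, comult G (gam g) = legl G (gam g) * legr G (gam g).

(* w = exp (2 i pi / n) *)
Definition zeta (n : nat) : R[i] :=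
  cos (2 * pi / n%:R) +i* sin (2 * pi / n%:R).

Variables (A : cstarType R) (gam : Gamma -> A).

(* Indices are shifted by one, which changes no difference k - l. *)
Definition fourier_magic (g : Gamma) (n : nat) : 'M[A]_n :=
  \matrix_(k, l) ((n%:R^-1 : R[i]) *:
    \sum_(1 <= m < n.+1)
      (zeta n ^ ((k%:Z - l%:Z) * m%:Z)) *: gam (g ^+ m)%g).

Definition fourier_equiv (g h : Gamma) : Prop :=
  exists (n : nat) (s : 'S_n),
    [/\ has_order g n, has_order h n &
        fourier_magic h n =
          perm_mx s *m fourier_magic g n *m perm_mx (s^-1)%g].

Definition total_dual : Prop :=
  forall (g h : Gamma) (n m : nat), has_order g n -> has_order h m ->
  forall (i j : 'I_n) (k l : 'I_m),
    fourier_magic g n i j * fourier_magic h m k l = 0 -> fourier_equiv g h.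

(* After the relabelling e, u is block diagonal; the block of index b is     *)
(* u^(g_(lab b)), so the multiplicity of g_p is the size of the fibre of lab *)
(* over p.                                                                   *)
Definition fourier_labelling N (u : 'M[A]_N)
    k (g : 'I_k -> Gamma) (n : 'I_k -> nat) : Prop :=
  (forall p, has_order (g p) (n p)) /\
  (forall p q, p <> q -> ~ fourier_equiv (g p) (g q)) /\
  exists (r : nat) (lab : 'I_r -> 'I_k)
         (e : forall b, 'I_(n (lab b)) -> 'I_N),
    [/\ forall p, exists b, lab b = p,
        bijective (fun x : {b : 'I_r & 'I_(n (lab b))} =>
          e (tag x) (tagged x)),
        forall b i j,
          u (e b i) (e b j) = fourier_magic (g (lab b)) (n (lab b)) i j &
        forall b c i j, b <> c -> u (e b i) (e c j) = 0].

Definition fourier_type N (u : 'M[A]_N) : Prop :=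
  exists k (g : 'I_k -> Gamma) (n : 'I_k -> nat), fourier_labelling u g n.

End GroupDual.

(* Main.v *)
Require Import Defs.
From HB Require Import structures.
From mathcomp Require Import all_boot all_order all_algebra all_fingroup.
From mathcomp Require Import complex.
From mathcomp Require Import all_classical all_reals all_analysis.
From mathcomp Require Import ring lra.

(** The entry [(i, j)] of the Fourier matrix of an element [x] of order [n] is a
    spectral projection of [x], depending on [i - j] only ([fproj]).  Matrices with
    such blocks make sense over any C*-algebra with unitaries [x p] of the right
    orders ([fourier_blocks]); they are magic, and the only question is whether
    they commute with the adjacency matrix [d] of the graph.

    The action of the dual of [Gamma] says that they do when [x p] is the group
    element [g_p].  Look at the block of [d] between two blocks of the magic
    matrix.  If the labels agree, commutation is a linear relation between the
    powers of one group element, and these are linearly independent; so it is a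
    relation between coefficients, which holds for every [x p] of that order
    ([fproj_transfer]).  If the labels differ, they are inequivalent, so by
    totality no entry of one block annihilates an entry of the other; this forces
    the block of [d] to be constant ([total_constant_block]), and constant blocks
    commute with all magic matrices.  Hence commutation holds for arbitrary
    unitaries of the given orders ([blocks_commute_transfer]).

    Applied to the generators of the cyclic factors, this gives the action of the
    dual of the free product.  What remains is that the block matrix is a quantum
    permutation matrix of that dual ([blocks_embedding]): the counit and antipode
    come from the universal property of the full group C*-algebra, the antipode
    through the opposite algebra, and the entries generate because the generators
    of the factors generate the free product ([free_product_generated]).

    For the Frucht property, suppose that the dual of a finite total group is
    the full quantum automorphism group of a graph.  Then every choice of
    unitaries of the given orders, in any C*-algebra, induces a representation of
    the group algebra.  If two different labels have order at least 2, represent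
    them by complex reflections along two lines in the plane, and all other labels
    trivially.  The angle between the lines is recovered as an eigenvalue of a
    fixed element of the group algebra, and can be chosen freely; but an element
    of a finite-dimensional algebra has finitely many eigenvalues
    ([two_blocks_infinite]).  So at most one label has order at least 2, the labels
    commute, and since their Fourier matrices generate the algebra, the group is
    abelian ([commuting_labels_abelian]). *)

Set Implicit Arguments.
Unset Strict Implicit.
Unset Printing Implicit Defensive.

Import Order.TTheory GRing.Theory Num.Theory.
Local Open Scope classical_set_scope.
Local Open Scope complex_scope.
Local Open Scope ring_scope.

(** * Spectral projections of an element of finite order *)

Section Characters.
Variables (K : fieldType) (n : nat) (z : K).
Hypothesis zP : n.-primitive_root z.

Let n0 : (0 < n)%N. Proof. exact: prim_order_gt0 zP. Qed.

Lemma prim_root_neq0 : z != 0.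
Proof.
apply/eqP => z0; have /eqP := prim_expr_order zP.
by rewrite z0 expr0n gtn_eqF // eq_sym oner_eq0.
Qed.

Let zD (a b : int) : z ^ (a + b) = z ^ a * z ^ b.
Proof. by rewrite expfzDr ?prim_root_neq0. Qed.

Lemma prim_exprz_eq1 (a : int) : (z ^ a == 1) = (n%:Z %| a)%Z.
Proof.
rewrite dvdzE /= (prim_order_dvd zP).
by case: a => a //=; rewrite NegzE -exprnN invr_eq1.
Qed.

(** Orthogonality of characters: the sum telescopes after multiplication by
    [z ^ a - 1], unless this factor vanishes. *)
Lemma character_sum (a : int) :
  \sum_(1 <= m < n.+1) z ^ (a * m%:Z) = (n * (n%:Z %| a)%Z)%:R.
Proof.
under eq_bigr => m _ do rewrite -exprz_exp.
rewrite -prim_exprz_eq1; have [->|z1] := eqVneq (z ^ a) 1.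
  under eq_bigr => m _ do rewrite exp1rz.
  by rewrite big_const_nat iter_addr_0 subn1 /= muln1.
rewrite muln0; apply: (mulfI (_ : z ^ a - 1 != 0)); first by rewrite subr_eq0.
rewrite mulr0 mulr_sumr.
under eq_bigr => m _ do rewrite mulrBl mul1r -[_ * _]exprS -exprnP.
rewrite (telescope_sumr (fun m => (z ^ a) ^+ m)) // expr1 exprS.
suff -> : (z ^ a) ^+ n = 1 by rewrite mulr1 subrr.
by rewrite exprnP exprzAC -exprnP (prim_expr_order zP) exp1rz.
Qed.

Lemma character_sum_ord (a : int) :
  \sum_(j < n) z ^ (a * j%:Z) = (n * (n%:Z %| a)%Z)%:R.
Proof.
rewrite -character_sum -(big_mkord xpredT (fun j => z ^ (a * j%:Z))).
rewrite big_ltn // big_nat_recr //= addrC; congr (_ + _).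
rewrite mulr0 expr0z; apply/esym/eqP; rewrite prim_exprz_eq1.
exact: dvdz_mull.
Qed.

Section Projections.
Variables (A : algType K) (x : A).

(** For [x ^+ n = 1] this is the spectral projection of [x] at the eigenvalue
    [z ^ (- a)].  The entry [(i, j)] of the Fourier matrix of [x] is the one with
    [a = i - j], so integer indices spare all arithmetic modulo [n]. *)
Definition fproj (a : int) : A :=
  n%:R^-1 *: \sum_(1 <= m < n.+1) z ^ (a * m%:Z) *: x ^+ m.

Hypothesis xn : x ^+ n = 1.

Let nK0 : n%:R != 0 :> K. Proof. exact: prim_root_natf_neq0 zP. Qed.

(** Multiplication by [x] shifts the summation index, and the boundary terms
    agree because [x ^+ n = 1]. *)
Lemma fproj_eigen a : x * fproj a = z ^ (- a) *: fproj a.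
Proof.
rewrite /fproj -scalerAr scalerA [_ ^ _ * _]mulrC -scalerA; congr (_ *: _).
rewrite mulr_sumr scaler_sumr; apply/eqP; rewrite -subr_eq0 -sumrB.
pose c m : A := z ^ (a * (m%:Z - 1)) *: x ^+ m.
rewrite (eq_bigr (fun m => c m.+1 - c m)) => [|m _]; last first.
  rewrite /c -scalerAr -exprS scalerA -zD.
  by rewrite intS (addrC 1) addrK mulrBr mulr1 [- a + _]addrC.
rewrite telescope_sumr // /c subrr mulr0 expr0z scale1r expr1 exprS xn mulr1.
rewrite -{2}(scale1r x) -scalerBl scaler_eq0; apply/orP; left.
by rewrite subr_eq0 prim_exprz_eq1 // intS addrAC subrr add0r dvdz_mull.
Qed.

Lemma fproj_eigenX m a : x ^+ m * fproj a = z ^ (- (a * m%:Z)) *: fproj a.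
Proof.
elim: m => [|m IHm]; first by rewrite mulr0 oppr0 expr0z scale1r expr0 mul1r.
rewrite exprSr -mulrA fproj_eigen -scalerAr IHm scalerA -zD.
by rewrite intS mulrDr mulr1 opprD.
Qed.

Lemma fproj_eigenVX (y : A) m a :
  y * x = 1 -> y ^+ m * fproj a = z ^ (a * m%:Z) *: fproj a.
Proof.
move=> yx; have yp b : y * fproj b = z ^ b *: fproj b.
  have e : z ^ b *: (x * fproj b) = fproj b.
    by rewrite fproj_eigen scalerA -zD subrr expr0z scale1r.
  by rewrite -{1}e -scalerAr mulrA yx mul1r.
elim: m => [|m IHm]; first by rewrite mulr0 expr0z scale1r expr0 mul1r.
by rewrite exprSr -mulrA yp -scalerAr IHm scalerA -zD intS mulrDr mulr1.
Qed.

Lemma fprojM a b : fproj a * fproj b = (n%:Z %| a - b)%Z%:R *: fproj b.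
Proof.
rewrite {1}/fproj -scalerAl mulr_suml.
under eq_bigr => m _ do rewrite -scalerAl fproj_eigenX scalerA -zD -mulrBl.
by rewrite -scaler_suml scalerA character_sum natrM mulrA mulVf // mul1r.
Qed.

(** The left factor has the form of the adjoint of [fproj a] when [y] is the
    adjoint of [x]; this identity then makes [fproj a] self-adjoint. *)
Lemma fprojV (y : A) a :
  y * x = 1 ->
  (n%:R^-1 *: \sum_(1 <= m < n.+1) (z ^ (a * m%:Z))^-1 *: y ^+ m) * fproj a = fproj a.
Proof.
move=> yx; rewrite -scalerAl mulr_suml (eq_bigr (fun=> fproj a)) => [|m _].
  by rewrite sumr_const_nat subn1 -scaler_nat scalerA mulVf ?scale1r.
rewrite -scalerAl fproj_eigenVX // scalerA mulVf ?scale1r //.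
by rewrite expfz_neq0 // prim_root_neq0.
Qed.

Lemma fproj_sum a : \sum_(j < n) fproj (a - j%:Z) = 1.
Proof.
rewrite -scaler_sumr exchange_big /=.
rewrite (eq_big_nat _ _ (F2 := fun m => (n * (m == n)%N)%:R *: x ^+ m)) => [|m /andP[m1 mn]].
  rewrite big_nat_recr //= eqxx muln1 big_nat big1 ?add0r => [|m /andP[_ mn]].
    by rewrite scalerA mulVf // scale1r xn.
  by rewrite (ltn_eqF mn) muln0 scale0r.
(* The characters cancel except at [m = n], the only multiple of [n] in range. *)
rewrite -scaler_suml; congr (_ *: _).
under eq_bigr => j _ do rewrite mulrBl zD [_ * m%:Z in X in _ * X]mulrC -mulNr.
rewrite -mulr_sumr character_sum_ord // dvdzE /= abszN /=.
have [->|nm] := eqVneq m n.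
  rewrite dvdnn muln1; have /eqP -> : z ^ (a * n) == 1.
    by rewrite prim_exprz_eq1 dvdz_mull.
  by rewrite mul1r.
by rewrite gtnNdvd ?muln0 ?mulr0 // ltn_neqAle nm -ltnS.
Qed.

Lemma fproj_shift a b : (n%:Z %| a - b)%Z -> fproj a = fproj b.
Proof.
move=> nab; congr (_ *: _); apply: eq_bigr => m _; congr (_ *: _).
rewrite -[a](subrK b) mulrDl zD; have /eqP -> : z ^ ((a - b) * m) == 1.
  by rewrite prim_exprz_eq1 dvdz_mulr.
by rewrite mul1r.
Qed.

Lemma fproj_sum_rev b : \sum_(i < n) fproj (i%:Z - b) = 1.
Proof.
(* The reflection [i |-> n - 1 - i] turns this sum into the previous one. *)
case: n n0 (fproj_sum (n%:Z - 1 - b)) fproj_shift => // k _ <- sh.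
rewrite (reindex_inj rev_ord_inj); apply: eq_bigr => i _; congr fproj.
rewrite /= subSS -subzn; last by rewrite -ltnS.
by rewrite intS (addrC 1) addrK addrAC.
Qed.

(** Fourier inversion: the projections sum to [1], and [x ^+ m] acts on each of
    them by a scalar. *)
Lemma fproj_inversion m (b : int) :
  x ^+ m = \sum_(k < n) z ^ (- ((k%:Z - b) * m%:Z)) *: fproj (k%:Z - b).
Proof.
rewrite -[LHS]mulr1 -(fproj_sum_rev b) mulr_sumr.
by apply: eq_bigr => j _; rewrite fproj_eigenX.
Qed.

Lemma fproj_comb m (a : 'I_m -> int) (c : 'I_m -> nat) :
  \sum_k fproj (a k) *+ c k =
  \sum_(i < n) (n%:R^-1 * \sum_k z ^ (a k * i.+1%:Z) *+ c k) *: x ^+ i.+1.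
Proof.
under [RHS]eq_bigr => i _ do rewrite -scalerA scaler_suml.
rewrite -scaler_sumr exchange_big scaler_sumr; apply: eq_bigr => k _.
rewrite /fproj scalerMnr big_add1 /= big_mkord -sumrMnl; congr (_ *: _).
by apply: eq_bigr => i _; rewrite scalerMnl.
Qed.

End Projections.

Lemma fproj1 (A : algType K) (a : int) : fproj (1 : A) a = (n%:Z %| a)%Z%:R.
Proof.
rewrite /fproj; under eq_bigr => m _ do rewrite expr1n.
rewrite -scaler_suml scalerA character_sum natrM mulrA mulVf ?mul1r ?scaler_nat //.
exact: prim_root_natf_neq0 zP.
Qed.

(** Coefficients with respect to the powers of [x] do not depend on the algebra,
    so a linear relation between the projections of a free [x] holds for every
    [y]. *)
Lemma fproj_transfer (A B : algType K) (x : A) (y : B) m1 m2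
    (a : 'I_m1 -> int) (c : 'I_m1 -> nat) (b : 'I_m2 -> int) (d : 'I_m2 -> nat) :
  lin_free (fun i : 'I_n => x ^+ i.+1) ->
  \sum_k fproj x (a k) *+ c k = \sum_k fproj x (b k) *+ d k ->
  \sum_k fproj y (a k) *+ c k = \sum_k fproj y (b k) *+ d k.
Proof.
move=> xf; rewrite !fproj_comb => /eqP; rewrite -subr_eq0 -sumrB.
under eq_bigr => i _ do rewrite -scalerBl.
move=> /eqP/xf e; apply: eq_bigr => i _; congr (_ *: _).
by apply/eqP; rewrite -subr_eq0 e.
Qed.

(** This identity turns the group-like coproduct [x |-> x (x) x] into matrix
    multiplication of Fourier matrices: expand [y ^+ m] by Fourier inversion. *)
Lemma fproj_convolution (A : algType K) (x y : A) (i j : int) :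
  x * y = y * x -> y ^+ n = 1 ->
  fproj (x * y) (i - j) = \sum_(k < n) fproj x (i - k%:Z) * fproj y (k%:Z - j).
Proof.
move=> xy yn; rewrite /fproj.
under eq_bigr => m _ do rewrite (exprMn_comm _ xy) (fproj_inversion yn m j) mulr_sumr scaler_sumr.
rewrite exchange_big scaler_sumr; apply: eq_bigr => k _.
rewrite -scalerAl mulr_suml; congr (_ *: _); apply: eq_bigr => m _.
by rewrite -scalerAl -scalerAr scalerA -zD -mulNr -mulrDl opprB addrA subrK.
Qed.

End Characters.

Lemma fproj_comm (K : fieldType) (A : algType K) n1 n2 (z1 z2 : K) (x y : A) (a b : int) :
  x * y = y * x -> fproj n1 z1 x a * fproj n2 z2 y b = fproj n2 z2 y b * fproj n1 z1 x a.
Proof.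
move=> xy; rewrite /fproj -!scalerAl -!scalerAr scalerA mulrC -scalerA.
congr (_ *: (_ *: _)); rewrite mulr_suml mulr_sumr; apply: eq_bigr => m _.
rewrite -scalerAl -scalerAr; congr (_ *: _).
rewrite mulr_suml mulr_sumr; apply: eq_bigr => l _.
rewrite -scalerAl -scalerAr; congr (_ *: _).
exact: (commrX _ (commr_sym (commrX _ (commr_sym xy)))).
Qed.

(** * Roots of unity and elementary facts on C*-algebras *)

Section RootsOfUnity.
Variable R : realType.

Lemma zetaX n m :
  zeta R n ^+ m = cos (2 * pi / n%:R *+ m) +i* sin (2 * pi / n%:R *+ m).
Proof.
elim: m => [|m IHm]; first by rewrite expr0 !mulr0n cos0 sin0.
rewrite exprS IHm !mulrS cosD sinD /zeta; simpc.
by rewrite [X in _ +i* X]addrC.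
Qed.

(** If [zeta ^+ m = 1], the half-angle formula gives [sin (pi m / n) = 0], which
    is impossible for [0 < m < n]. *)
Lemma zeta_prim n : (0 < n)%N -> n.-primitive_root (zeta R n).
Proof.
move=> n0; have nR : (n%:R : R) != 0 by rewrite pnatr_eq0 -lt0n.
apply/andP; split=> //; apply/forallP => i; rewrite unity_rootE.
set m := i.+1; rewrite zetaX; apply/eqP.
have -> : 2 * pi / n%:R *+ m = (pi * m%:R / n%:R) *+ 2 :> R.
  by rewrite -mulr_natr -[in RHS]mulr_natl mulrAC !mulrA.
have [mn|mn] := eqVneq m n.
  by rewrite mn mulfK // cos2pi sin2pi eqxx.
have {mn}mn : (m < n)%N by rewrite ltn_neqAle mn ltn_ord.
apply/negbTE/negP => /eqP[].
rewrite cos_mulr2n => /eqP; rewrite subr_eq -mulr2n eqrMn2r //= => /eqP c1 _.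
have : 0 < sin (pi * m%:R / n%:R : R).
  apply: sin_gt0_pi; rewrite divr_gt0 ?mulr_gt0 ?pi_gt0 ?ltr0n //=.
  by rewrite ltr_pdivrMr ?ltr0n // ltr_pM2l ?pi_gt0 // ltr_nat.
by move=> /(exprn_gt0 2); rewrite sin2cos2 c1 subrr ltxx.
Qed.

Lemma conj_zeta n : (zeta R n)^* = (zeta R n)^-1.
Proof.
have zz : zeta R n * (zeta R n)^* = 1.
  by rewrite /zeta; simpc; rewrite -!expr2 cos2Dsin2 mulrC addNr.
have z0 : zeta R n != 0.
  by apply/eqP => z0; move: zz; rewrite z0 mul0r => /esym/eqP; rewrite oner_eq0.
by apply: (mulfI z0); rewrite mulfV.
Qed.

Lemma conj_zetaXz n (a : int) : (zeta R n ^ a)^* = (zeta R n ^ a)^-1.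
Proof.
case: a => a; first by rewrite -exprnP rmorphXn /= conj_zeta exprVn.
by rewrite NegzE -exprnN fmorphV rmorphXn /= conj_zeta exprVn.
Qed.

End RootsOfUnity.

Section CStarTheory.
Variables (R : realType) (A : cstarType R).
Implicit Types x y : A.

Lemma star0 : star (0 : A) = 0.
Proof. by rewrite -{1}(scale0r (0 : A)) starZ rmorph0 scale0r. Qed.

Lemma star_sum I (r : seq I) (P : pred I) (F : I -> A) :
  star (\sum_(i <- r | P i) F i) = \sum_(i <- r | P i) star (F i).
Proof. exact: (big_morph _ (@starD _ _) star0). Qed.

Lemma star1 : star (1 : A) = 1.
Proof. by rewrite -[LHS]mulr1 -{2}[1]starK -starM mulr1 starK. Qed.

Lemma starX x m : star (x ^+ m) = star x ^+ m.
Proof. by elim: m => [|m IHm]; rewrite ?star1 // exprSr starM IHm -exprS. Qed.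

Lemma cnorm0 : cnorm (0 : A) = 0.
Proof. by rewrite -(scale0r (0 : A)) cnormZ Normc.normc0 mul0r. Qed.

Lemma cnormN x : cnorm (- x) = cnorm x.
Proof. by rewrite -scaleN1r cnormZ /= !sqrrN expr1n expr0n addr0 sqrtr1 mul1r. Qed.

Lemma cnorm_ge0 x : 0 <= cnorm x.
Proof.
have := cnormD x (- x); rewrite subrr cnorm0 cnormN -mulr2n.
by rewrite pmulrn_lge0.
Qed.

Lemma cnorm_small0 x : (forall e, 0 < e -> cnorm x < e) -> x = 0.
Proof.
move=> xe; apply: cnorm_eq0; apply/eqP; rewrite eq_le cnorm_ge0 andbT.
by apply/ler_addgt0Pl => e /xe/ltW; rewrite addr0.
Qed.

(** From [cnorm y ^+ 2 = cnorm (star y * y) <= cnorm (star y) * cnorm y]. *)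
Lemma cnorm_star x : cnorm (star x) = cnorm x.
Proof.
have le y : cnorm y <= cnorm (star y).
  have [->|] := eqVneq (cnorm y) 0; first exact: cnorm_ge0.
  move=> y0; have {}y0 : 0 < cnorm y by rewrite lt_def y0 cnorm_ge0.
  by rewrite -(ler_pM2r y0) -expr2 -cnorm_starM cnormM.
by apply/eqP; rewrite eq_le le -{2}[x]starK le.
Qed.

(** An element [p] with [star p * p = p] is self-adjoint, and on the range of [p]
    the powers of [star x] act by the inverse scalars. *)
Lemma star_fproj x n a : (0 < n)%N -> x ^+ n = 1 -> star x * x = 1 ->
  star (fproj n (zeta R n) x a) = fproj n (zeta R n) x a.
Proof.
move=> n0 xn xU; have zP := zeta_prim R n0.
set p := fproj _ _ _ _; suff pp : star p * p = p.
  by rewrite -[RHS]pp -{1}pp starM starK.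
rewrite -[RHS](fprojV zP xn _ xU); congr (_ * _).
rewrite /p /fproj starZ star_sum fmorphV rmorph_nat; congr (_ *: _).
by apply: eq_bigr => m _; rewrite starZ starX conj_zetaXz.
Qed.

(** The right-hand side is self-adjoint, and its adjoint is the left-hand side. *)
Lemma fproj_star x n a : (0 < n)%N -> x ^+ n = 1 -> star x * x = 1 ->
  fproj n (zeta R n) (star x) a = fproj n (zeta R n) x (- a).
Proof.
move=> n0 xn xU; rewrite -[RHS]star_fproj // /fproj starZ star_sum fmorphV rmorph_nat.
congr (_ *: _); apply: eq_bigr => m _.
by rewrite starZ starX conj_zetaXz mulNr -invr_expz invrK.
Qed.

Lemma subalg_sum (S : set A) I (s : seq I) (P : pred I) (F : I -> A) :
  cstar_subalg S -> (forall i, P i -> S (F i)) -> S (\sum_(i <- s | P i) F i).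
Proof.
move=> Salg SF; apply: (big_ind S) => //; last exact: subalgD.
by rewrite -(scale0r (1 : A)); exact/(subalgZ Salg)/(subalg1 Salg).
Qed.

Lemma subalg_dense (S T : set A) : cstar_subalg S -> cdense T -> T `<=` S -> S = setT.
Proof.
move=> Salg Td TS; apply/seteqP; split=> // x _; apply: (subalg_cclosed Salg) => eps e0.
have : cclosure T x by rewrite Td.
by move=> /(_ eps e0)[y /TS Sy xy]; exists y.
Qed.

End CStarTheory.

Lemma starhom_fproj (R : realType) (A B : cstarType R) (f : starhom A B) n z x a :
  f (fproj n z x a) = fproj n z (f x) a.
Proof.
rewrite linearZ linear_sum; congr (_ *: _); apply: eq_bigr => m _.
by rewrite linearZ rmorphXn.
Qed.

(** * Block diagonal matrices with Fourier blocks *)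

Section BlockMatrices.
Variables (R : realType) (N k r : nat) (n : 'I_k -> nat) (lab : 'I_r -> 'I_k).
Hypothesis n0 : forall p, (0 < n p)%N.
Variable e : forall b, 'I_(n (lab b)) -> 'I_N.
Hypothesis e_bij : bijective (fun s : {b : 'I_r & 'I_(n (lab b))} => e (tagged s)).

Definition label_proj (A : cstarType R) (x : 'I_k -> A) p (a : int) : A :=
  fproj (n p) (zeta R (n p)) (x p) a.

(** A relation instead of an explicit matrix: it applies both to matrices built
    below and to the block form that a given labelling provides. *)
Definition fourier_blocks (A : cstarType R) (x : 'I_k -> A) (u : 'M[A]_N) : Prop :=
  (forall b i j, u (e (b:=b) i) (e (b:=b) j) = label_proj x (lab b) (i%:Z - j%:Z)) /\
  (forall b c (i : 'I_(n (lab b))) (j : 'I_(n (lab c))), b <> c -> u (e i) (e j) = 0).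

Lemma block_index (s : 'I_N) : exists b (i : 'I_(n (lab b))), s = e i.
Proof.
have [f _ ef] := e_bij; exists (tag (f s)), (tagged (f s)).
by rewrite -[LHS]ef.
Qed.

Lemma sum_blocks (V : nmodType) (F : 'I_N -> V) :
  \sum_s F s = \sum_b \sum_i F (e (b:=b) i).
Proof.
rewrite (reindex _ (onW_bij _ e_bij)) sig_big_dep /=.
by apply: eq_bigr => -[].
Qed.

Lemma fourier_blocks_exists (A : cstarType R) (x : 'I_k -> A) :
  exists u, fourier_blocks x u.
Proof.
have [f fe ef] := e_bij.
exists (\matrix_(s, t) if tag (f s) == tag (f t)
  then label_proj x (lab (tag (f s))) ((tagged (f s))%:Z - (tagged (f t))%:Z) else 0).
have fE b (i : 'I_(n (lab b))) : f (e i) = Tagged (fun b => 'I_(n (lab b))) i.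
  by rewrite -[RHS]fe.
split=> [b i j|b c i j bc]; rewrite mxE !fE /= ?eqxx //.
by case: eqP.
Qed.

Lemma sum_block (V : nmodType) (F : 'I_N -> V) b :
  (forall c (j : 'I_(n (lab c))), b <> c -> F (e j) = 0) ->
  \sum_s F s = \sum_i F (e (b:=b) i).
Proof.
move=> F0; rewrite sum_blocks (bigD1 b) //= [X in _ + X]big1 ?addr0 // => c cb.
by apply: big1 => j _; apply: F0 => bc; rewrite bc eqxx in cb.
Qed.

Section OneAlgebra.
Variables (A : cstarType R) (x : 'I_k -> A) (u : 'M[A]_N).
Hypotheses (xn : forall p, x p ^+ n p = 1) (ux : fourier_blocks x u).

Let zP p := zeta_prim R (n0 p).

Lemma blocks_diag b (i j : 'I_(n (lab b))) :
  u (e i) (e j) = label_proj x (lab b) (i%:Z - j%:Z).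
Proof. exact: ux.1. Qed.

Lemma blocks_off b c (i : 'I_(n (lab b))) (j : 'I_(n (lab c))) :
  b <> c -> u (e i) (e j) = 0.
Proof. exact: ux.2. Qed.

Lemma magic_blocks : (forall p, star (x p) * x p = 1) -> magic u.
Proof.
move=> xU; split=> [s t|s t|s|t].
- have [b [i ->]] := block_index s; have [c [j ->]] := block_index t.
  have [bc|bc] := pselect (b = c); last by rewrite blocks_off // mul0r.
  case: c / bc j => j; rewrite blocks_diag /label_proj (fprojM (zP _)) //.
  by rewrite subrr dvdz0 scale1r.
- have [b [i ->]] := block_index s; have [c [j ->]] := block_index t.
  have [bc|bc] := pselect (b = c); last by rewrite blocks_off // star0.
  by case: c / bc j => j; rewrite blocks_diag /label_proj star_fproj.
- have [b [i ->]] := block_index s.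
  rewrite (@sum_block _ _ b) => [|c j bc]; last by rewrite blocks_off.
  by under eq_bigr => j _ do rewrite blocks_diag; exact: (fproj_sum (zP _)).
- have [b [j ->]] := block_index t.
  rewrite (@sum_block _ _ b) => [|c i bc]; last by rewrite blocks_off //; apply: nesym.
  by under eq_bigr => i _ do rewrite blocks_diag; exact: (fproj_sum_rev (zP _)).
Qed.

Lemma blocks_generator b :
  x (lab b) = \sum_(i < n (lab b)) zeta R (n (lab b)) ^ (- i%:Z) *:
                u (e i) (e (Ordinal (n0 (lab b)))).
Proof.
have := fproj_inversion (zP (lab b)) (xn (lab b)) 1 0; rewrite expr1 => ->.
by apply: eq_bigr => i _; rewrite blocks_diag subr0 mulr1.
Qed.

Variable X : graph N.

(** Read blockwise, commutation with the adjacency matrix involves one pair of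
    blocks at a time. *)
Lemma blocks_commuteP :
  adjacency A X *m u = u *m adjacency A X <->
  forall b c (i : 'I_(n (lab b))) (l : 'I_(n (lab c))),
    \sum_(j < n (lab c)) label_proj x (lab c) (j%:Z - l%:Z) *+ X (e i) (e (b:=c) j) =
    \sum_(j < n (lab b)) label_proj x (lab b) (i%:Z - j%:Z) *+ X (e (b:=b) j) (e l).
Proof.
have E b c (i : 'I_(n (lab b))) (l : 'I_(n (lab c))) :
  (adjacency A X *m u) (e i) (e l) =
    \sum_(j < n (lab c)) label_proj x (lab c) (j%:Z - l%:Z) *+ X (e i) (e (b:=c) j) /\
  (u *m adjacency A X) (e i) (e l) =
    \sum_(j < n (lab b)) label_proj x (lab b) (i%:Z - j%:Z) *+ X (e (b:=b) j) (e l).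
  rewrite !mxE; split.
    rewrite (@sum_block _ _ c) => [|d j cd]; last first.
      by rewrite blocks_off ?mulr0 //; apply: nesym.
    by apply: eq_bigr => j _; rewrite mxE mulr_natl blocks_diag.
  rewrite (@sum_block _ _ b) => [|d j bd]; last by rewrite blocks_off ?mul0r.
  by apply: eq_bigr => j _; rewrite mxE mulr_natr blocks_diag.
split=> [/matrixP h b c i l|h].
  by have [<- <-] := E b c i l; exact: h.
apply/matrixP => s t.
have [b [i ->]] := block_index s; have [c [l ->]] := block_index t.
by have [-> ->] := E b c i l; exact: h.
Qed.

End OneAlgebra.

End BlockMatrices.

(** Blocks are preserved by the coproduct formula, since a product through a
    third block has a zero factor; inside a block it is [fproj_convolution]. *)
Lemma comult_blocks (R : realType) (H : cqg R) (N k r : nat) (n : 'I_k -> nat)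
    (lab : 'I_r -> 'I_k) (e : forall b, 'I_(n (lab b)) -> 'I_N)
    (x : 'I_k -> H) (u : 'M[H]_N) :
  (forall p, (0 < n p)%N) ->
  bijective (fun s : {b : 'I_r & 'I_(n (lab b))} => e _ (tagged s)) ->
  (forall p, x p ^+ n p = 1) -> fourier_blocks e x u ->
  (forall p, comult H (x p) = legl H (x p) * legr H (x p)) ->
  comult_magic u.
Proof.
move=> n0 e_bij xn ux xD s t.
have [b [i ->]] := block_index e_bij s; have [c [j ->]] := block_index e_bij t.
rewrite (sum_block e_bij (b := b)) => [|d l bd]; last first.
  by rewrite (blocks_off ux) // rmorph0 mul0r.
have [bc|bc] := pselect (b = c); last first.
  rewrite (blocks_off ux) // rmorph0 big1 // => l _.
  by rewrite (blocks_off ux _ _ bc) rmorph0 mulr0.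
case: c / bc j => j.
rewrite (blocks_diag ux) /label_proj starhom_fproj xD.
rewrite (fproj_convolution (zeta_prim R (n0 _))).
- by apply: eq_bigr => l _; rewrite !(blocks_diag ux) /label_proj !starhom_fproj.
- by have [hc _] := cqg_tensor H; exact: (tensor_comm hc).
- by rewrite -rmorphXn xn rmorph1.
Qed.

(** * Totality and commutation with the adjacency matrix *)

Lemma dvdz_sub_ord n (a b : 'I_n) : (n%:Z %| a%:Z - b%:Z)%Z = (a == b).
Proof.
by rewrite -eqz_mod_dvd !modz_nat eqz_nat !modn_small.
Qed.

Section GroupDualBlocks.
Variables (R : realType) (Gamma : groupType) (A : cstarType R) (gam : Gamma -> A).
Hypothesis gamA : full_group_cstar gam.

Lemma gamX (g : Gamma) m : gam (g ^+ m)%g = gam g ^+ m.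
Proof.
elim: m => [|m IHm]; first by rewrite expg0 gam1.
by rewrite expgS gamM // IHm exprS.
Qed.

Lemma gam_unitary g : star (gam g) * gam g = 1.
Proof. by rewrite gam_star // -gamM // mulVg gam1. Qed.

Lemma gam_order g n : has_order g n -> gam g ^+ n = 1.
Proof. by case=> _ gn _; rewrite -gamX gn gam1. Qed.

Lemma fourier_magicE g n (i j : 'I_n) :
  fourier_magic gam g n i j = fproj n (zeta R n) (gam g) (i%:Z - j%:Z).
Proof.
by rewrite mxE; congr (_ *: _); apply: eq_bigr => m _; rewrite gamX.
Qed.

(** The powers [g ^+ 1, ..., g ^+ n] are distinct group elements. *)
Lemma gam_powers_free g n :
  has_order g n -> lin_free (fun i : 'I_n => gam g ^+ i.+1).
Proof.
case=> n0 gn gm; have inj : injective (fun i : 'I_n => (g ^+ i.+1)%g).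
  have lt (a b : 'I_n) : (a < b)%N -> (g ^+ a.+1)%g <> (g ^+ b.+1)%g.
    move=> ab eab; apply: (gm (b - a)%N).
      by rewrite subn_gt0 ab (leq_ltn_trans (leq_subr _ _)).
    apply: (mulgI (g ^+ a.+1)%g); rewrite -expgnDr mulg1 eab.
    by rewrite -subSS subnKC // ltnW.
  move=> a b eab; apply/val_inj/eqP.
  by case: ltngtP => // /lt; rewrite eab.
have := gam_free gamA inj; congr (lin_free _).
by apply/funext => i; rewrite /= gamX.
Qed.

(** The heart of the matter.  Let [P] be the common value of the two sums.  If
    [D j l] holds then multiplying by [p = u^g_ij] on the left of the right-hand
    sum gives [p * P = p], because a row of a Fourier matrix consists of
    orthogonal projections; if [D i k] fails then [P * p' = 0] for [p' = u^h_kl]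
    for the same reason.  Both together give [p * p' = 0], which the hypothesis
    excludes.  So one edge between two blocks forces all of them. *)
Lemma total_constant_block (g h : Gamma) (n m : nat) (D : 'I_n -> 'I_m -> bool) :
  has_order g n -> has_order h m ->
  (forall (i j : 'I_n) (k l : 'I_m),
    fourier_magic gam g n i j * fourier_magic gam h m k l <> 0) ->
  (forall (i : 'I_n) (l : 'I_m),
    \sum_(k < m) fourier_magic gam h m k l *+ D i k =
    \sum_(j < n) fourier_magic gam g n i j *+ D j l) ->
  forall i j k l, D j l -> D i k.
Proof.
move=> gn hm gh0 comm i j k l Djl; apply/negPn/negP => /negbTE Dik.
apply: (gh0 i j k l).
have zn := zeta_prim R (let: And3 p _ _ := gn in p).
have zm := zeta_prim R (let: And3 p _ _ := hm in p).
have P1 : fourier_magic gam g n i j *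
    (\sum_(a < n) fourier_magic gam g n i a *+ D a l) = fourier_magic gam g n i j.
  rewrite mulr_sumr (bigD1 j) //= Djl !fourier_magicE (fprojM zn) ?gam_order //.
  rewrite subrr dvdz0 scale1r big1 ?addr0 // => a aj.
  rewrite mulrnAr fourier_magicE (fprojM zn) ?gam_order //.
  have -> : i%:Z - j%:Z - (i%:Z - a%:Z) = a%:Z - j%:Z by rewrite opprB addrC addrA subrK.
  by rewrite dvdz_sub_ord (negbTE aj) scale0r mul0rn.
have P0 : (\sum_(a < m) fourier_magic gam h m a l *+ D i a) *
    fourier_magic gam h m k l = 0.
  rewrite mulr_suml big1 // => a _; have [->|ak] := eqVneq a k.
    by rewrite Dik mul0r.
  rewrite mulrnAl !fourier_magicE (fprojM zm) ?gam_order //.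
  have -> : a%:Z - l%:Z - (k%:Z - l%:Z) = a%:Z - k%:Z by rewrite opprB addrA subrK.
  by rewrite dvdz_sub_ord (negbTE ak) scale0r mul0rn.
by rewrite -P1 -comm -mulrA P0 mulr0.
Qed.

(** Between blocks with the same label, commutation is a linear relation between
    powers of a single group element, and [fproj_transfer] moves it to [B].
    Between blocks with different labels the adjacency matrix is constant, and
    commutation says that the rows of one Fourier matrix and the columns of the
    other have the same sum, which is [1] in [B] as well. *)
Lemma blocks_commute_transfer (N k r : nat) (n : 'I_k -> nat) (lab : 'I_r -> 'I_k)
    (e : forall b, 'I_(n (lab b)) -> 'I_N) (g : 'I_k -> Gamma)
    (B : cstarType R) (y : 'I_k -> B) (u : 'M[A]_N) (v : 'M[B]_N) (X : graph N) :
  total_dual gam ->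
  (forall p, has_order (g p) (n p)) ->
  (forall p q, p <> q -> ~ fourier_equiv gam (g p) (g q)) ->
  bijective (fun s : {b : 'I_r & 'I_(n (lab b))} => e _ (tagged s)) ->
  (forall p, y p ^+ n p = 1) ->
  fourier_blocks e (gam \o g) u -> fourier_blocks e y v ->
  adjacency A X *m u = u *m adjacency A X ->
  adjacency B X *m v = v *m adjacency B X.
Proof.
move=> tot gn ineq e_bij yn ugam vy.
have n0 p : (0 < n p)%N by case: (gn p).
move=> /(blocks_commuteP e_bij ugam) du; apply/(blocks_commuteP e_bij vy) => b c i l.
have zP p := zeta_prim R (n0 p).
have [bc|bc] := pselect (lab b = lab c).
  (* The index type depends on [lab c], so the label is replaced in the summands. *)
  have E (C : cstarType R) (w : 'I_k -> C) (F : 'I_(n (lab c)) -> int) :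
      \sum_(j < n (lab c)) label_proj n w (lab c) (F j) *+ X (e b i) (e c j) =
      \sum_(j < n (lab c)) label_proj n w (lab b) (F j) *+ X (e b i) (e c j).
    by apply: eq_bigr => j _; rewrite bc.
  have := du b c i l; rewrite !E /label_proj.
  exact: (fproj_transfer (a := fun j : 'I_(n (lab c)) => j%:Z - l%:Z)
    (c := fun j => X (e b i) (e c j)) (y (lab b)) (gam_powers_free (gn (lab b)))).
have gh0 (i1 j1 : 'I_(n (lab b))) (k1 l1 : 'I_(n (lab c))) :
  fourier_magic gam (g (lab b)) (n (lab b)) i1 j1 *
  fourier_magic gam (g (lab c)) (n (lab c)) k1 l1 <> 0.
  by move=> /(tot _ _ _ _ (gn _) (gn _)); exact: ineq.
have const := total_constant_block (D := fun j k => X (e b j) (e c k)) (gn _) (gn _) gh0.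
have {}const : forall j k, X (e b i) (e c j) = X (e b k) (e c l).
  have cst : forall i j k l, X (e b j) (e c l) -> X (e b i) (e c k).
    apply: const => i1 l1; have := du b c i1 l1; rewrite /label_proj /=.
    under eq_bigr do rewrite -fourier_magicE.
    by under [in RHS]eq_bigr do rewrite -fourier_magicE.
  by move=> j1 k1; apply/idP/idP; exact: cst.
have -> : \sum_(j < n (lab c)) label_proj n y (lab c) (j%:Z - l%:Z) *+ X (e b i) (e c j) =
    \sum_(j < n (lab c)) label_proj n y (lab c) (j%:Z - l%:Z) *+ X (e b i) (e c l).
  by apply: eq_bigr => j _; rewrite (const j i).
have -> : \sum_(j < n (lab b)) label_proj n y (lab b) (i%:Z - j%:Z) *+ X (e b j) (e c l) =
    \sum_(j < n (lab b)) label_proj n y (lab b) (i%:Z - j%:Z) *+ X (e b i) (e c l).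
  by apply: eq_bigr => j _; rewrite (const l j).
by rewrite !sumrMnl (fproj_sum (zP _)) // (fproj_sum_rev (zP _)).
Qed.

End GroupDualBlocks.

(** * The opposite C*-algebra *)

Section OppositeAlgebra.
Variables (R : realType) (A : cstarType R).

(** The antipode is a *-homomorphism into this algebra, so it comes from the
    universal property of the full group C*-algebra. *)
Definition opposite : Type := A.

HB.instance Definition _ := GRing.Lmodule.copy opposite A.

Definition opp_mul (x y : opposite) : opposite := (y : A) * (x : A).

Let opp_mulA : associative opp_mul.
Proof. by move=> x y z; rewrite /opp_mul mulrA. Qed.
Let opp_mul1r : left_id (1 : A) opp_mul.
Proof. by move=> x; rewrite /opp_mul mulr1. Qed.
Let opp_mulr1 : right_id (1 : A) opp_mul.
Proof. by move=> x; rewrite /opp_mul mul1r. Qed.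
Let opp_mulDl : left_distributive opp_mul +%R.
Proof. by move=> x y z; rewrite /opp_mul mulrDr. Qed.
Let opp_mulDr : right_distributive opp_mul +%R.
Proof. by move=> x y z; rewrite /opp_mul mulrDl. Qed.
Let opp_1neq0 : (1 : A) != 0 :> opposite.
Proof. exact: oner_neq0. Qed.

HB.instance Definition _ := GRing.Zmodule_isNzRing.Build opposite
  opp_mulA opp_mul1r opp_mulr1 opp_mulDl opp_mulDr opp_1neq0.

Let opp_scalerAl (a : R[i]) (x y : opposite) :
  a *: (x * y) = (a *: x : opposite) * y.
Proof. exact: (scalerAr a (y : A) (x : A)). Qed.

HB.instance Definition _ := GRing.Lmodule_isLalgebra.Build R[i] opposite opp_scalerAl.

Let opp_scalerAr (a : R[i]) (x y : opposite) :
  a *: (x * y) = x * (a *: y : opposite).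
Proof. exact: (scalerAl a (y : A) (x : A)). Qed.

HB.instance Definition _ := GRing.Lalgebra_isAlgebra.Build R[i] opposite opp_scalerAr.

Let opp_starM (x y : opposite) :
  star (opp_mul x y : A) = opp_mul (star (y : A)) (star (x : A)).
Proof. exact: (starM (y : A) (x : A)). Qed.

Let opp_cnormM (x y : opposite) :
  cnorm (opp_mul x y : A) <= cnorm (x : A) * cnorm (y : A).
Proof. by rewrite mulrC; exact: (cnormM (y : A) (x : A)). Qed.

Let opp_cnorm_starM (x : opposite) :
  cnorm (opp_mul (star (x : A)) x : A) = cnorm (x : A) ^+ 2.
Proof.
by have := cnorm_starM (star (x : A)); rewrite starK cnorm_star.
Qed.

HB.instance Definition _ := @isCStarAlgebra.Build R opposite
  (@star R A) (@cnorm R A) (@starK R A) (@starD R A) (@starZ R A) opp_starM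
  (@cnorm_eq0 R A) (@cnormD R A) (@cnormZ R A) opp_cnormM opp_cnorm_starM
  (@cnorm_complete R A).

End OppositeAlgebra.

(** * Generation of free products and of cyclic groups *)

Section SubgroupType.
Variables (F : groupType) (S : {pred F}) (Sg : group_closed S).

(** The proof [Sg] is a parameter of the type so that the group structure can be
    inferred from the type. *)
Definition subgroup_of of group_closed S : Type := {x : F | x \in S}.
Local Notation T := (subgroup_of Sg).

HB.instance Definition _ := SubChoice.copy T {x : F | x \in S}.
HB.instance Definition _ := SubChoice_isSubGroup.Build F S T Sg.

End SubgroupType.

(** The [iota p] corestrict to the subgroup [S], so the universal property gives a
    retraction [F -> S]; followed by the inclusion it agrees with the identity on
    the factors, hence everywhere. *)
Lemma free_product_generated k (K : 'I_k -> groupType) (F : groupType)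
    (iota : forall p, {multiplicative K p -> F}) (S : {pred F}) :
  free_product iota -> group_closed S ->
  (forall p z, iota p z \in S) -> forall x, x \in S.
Proof.
move=> fp Sg iS.
pose f p (z : K p) : subgroup_of Sg := Sub (iota p z) (iS p z).
have fM p : {morph f p : x y / (x * y)%g}.
  by move=> x y; apply/val_inj; rewrite /= gmulfM.
pose fm p : {multiplicative K p -> subgroup_of Sg} :=
  HB.pack (f p) (isMultiplicative.Build _ _ (f p) (fM p)).
have [[h hf] _] := fp _ fm.
have hM : {morph (val \o h) : x y / (x * y)%g} by move=> x y; rewrite /= gmulfM.
pose h' : {multiplicative F -> F} := HB.pack (val \o h) (isMultiplicative.Build _ _ _ hM).
have idM : {morph (@id F) : x y / (x * y)%g} by [].
pose i' : {multiplicative F -> F} := HB.pack (@id F) (isMultiplicative.Build _ _ _ idM).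
have [_ uniq] := fp _ iota.
move=> x; have <- : val (h x) = x.
  apply: (uniq h' i') => // p z.
  by rewrite /= hf.
exact: (valP (h x)).
Qed.

Definition cyclic_gen n : cyclic_grp n := inZp 1.

Lemma cyclic_genX n (z : cyclic_grp n) : z = (cyclic_gen n ^+ (z : 'I_n.-1.+1))%g.
Proof.
by rewrite Zp_expg; apply/val_inj; rewrite /= modnMml mul1n modn_small.
Qed.

Lemma cyclic_gen_order n : (0 < n)%N -> (cyclic_gen n ^+ n = 1)%g.
Proof.
move=> n0; rewrite Zp_expg; apply/val_inj.
by rewrite /= modnMml mul1n prednK // modnn.
Qed.

Lemma multiplicativeX (G H : groupType) (f : {multiplicative G -> H}) n :
  {morph f : x / (x ^+ n)%g}.
Proof.
have f1 : f 1%g = 1%g by apply: (mulgI (f 1%g)); rewrite -gmulfM !mulg1.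
by move=> x; elim: n => [//|n IHn]; rewrite !expgS gmulfM IHn.
Qed.

Lemma multiplicative_order (G H : groupType) (f : {multiplicative G -> H}) x n :
  (x ^+ n = 1 -> f x ^+ n = 1)%g.
Proof.
by move=> xn; rewrite -multiplicativeX xn -[1%g](expg0 x) multiplicativeX.
Qed.

(** * The embedding of the dual of a free product *)

Lemma opposite_fproj (R : realType) (A : cstarType R) n z (x : A) a :
  fproj n z (x : opposite A) a = fproj n z x a :> A.
Proof.
have opX m : (x : opposite A) ^+ m = x ^+ m :> A.
  elim: m => [|m IHm]; first by rewrite !expr0.
  by rewrite exprS [in RHS]exprSr -IHm.
congr (_ *: _); elim/big_rec2: _ => // m _ s _ <-.
by rewrite -opX.
Qed.

Section DualOfFreeProduct.
Variables (R : realType) (N k r : nat) (n : 'I_k -> nat) (lab : 'I_r -> 'I_k).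
Hypothesis n0 : forall p, (0 < n p)%N.
Hypothesis lab_surj : forall p, exists b, lab b = p.
Variable e : forall b, 'I_(n (lab b)) -> 'I_N.
Hypothesis e_bij : bijective (fun s : {b : 'I_r & 'I_(n (lab b))} => e (tagged s)).
Variables (F : groupType) (iota : forall p : 'I_k, {multiplicative cyclic_grp (n p) -> F}).
Hypothesis Ffree : free_product iota.
Variables (H : cqg R) (del : F -> H).
Hypothesis delH : group_dual del.

Let t p : F := iota p (cyclic_gen (n p)).
Let x p : H := del (t p).

Let delC := delH.1.

Let tn p : (t p ^+ n p = 1)%g.
Proof. exact/multiplicative_order/cyclic_gen_order. Qed.

Lemma free_generator_order p : x p ^+ n p = 1.
Proof. by rewrite -(gamX delC) tn (gam1 delC). Qed.

Let xU p : star (x p) * x p = 1. Proof. exact: gam_unitary. Qed.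

Variable v : 'M[H]_N.
Hypothesis vx : fourier_blocks e x v.

Let Tg b (i : 'I_(n (lab b))) := Tagged (fun b => 'I_(n (lab b))) i.

Let e_tagged b c (i : 'I_(n (lab b))) (j : 'I_(n (lab c))) : e i = e j -> Tg i = Tg j.
Proof. by move=> eij; apply: (bij_inj e_bij). Qed.

Let e_inj b : injective (e (b:=b)).
Proof. by move=> i j /e_tagged/eqP; rewrite eq_Tagged => /eqP. Qed.

Let e_block b c (i : 'I_(n (lab b))) (j : 'I_(n (lab c))) : b <> c -> e i <> e j.
Proof. by move=> bc /e_tagged/(congr1 tag). Qed.

(** Fourier inversion puts each [x p] in the span of its block.  The elements of
    [F] that are sent into a given C*-subalgebra form a subgroup, because the
    inverse is the adjoint, and that subgroup contains the factors. *)
Lemma blocks_generate : cstar_generated (entries v).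
Proof.
move=> S Salg Sv; have Sx p : S (x p).
  have [b <-] := lab_surj p; rewrite (blocks_generator n0 free_generator_order vx b).
  apply: subalg_sum => // i _; apply: (subalgZ Salg); apply: Sv.
  by eexists; eexists.
apply: (subalg_dense Salg (gam_dense delC)) => _ [m [c [w [wdel ->]]]].
apply: subalg_sum => // i _; apply: (subalgZ Salg).
have [f _ <-] := wdel i; apply/asboolP.
pose T : {pred F} := fun f => `[< S (del f) >].
have TE h : (h \in T) = `[< S (del h) >] by [].
apply: (free_product_generated (S := T) Ffree).
  split; first by rewrite TE (gam1 delC); apply: asboolT; exact: (subalg1 Salg).
  move=> f1 f2; rewrite !TE => /asboolP S1 /asboolP S2.
  rewrite (gamM delC) -(gam_star delC); apply: asboolT; apply: (subalgM Salg) => //.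
  exact: (subalg_star Salg).
move=> p z; rewrite TE [z]cyclic_genX multiplicativeX (gamX delC); apply: asboolT.
elim: (nat_of_ord _) => [|m' IHm]; first by rewrite expr0; exact: (subalg1 Salg).
by rewrite exprS; apply: (subalgM Salg) => //; exact: Sx.
Qed.

(** The counit is the trivial representation of [F]. *)
Lemma blocks_counit : exists eps : starhom H R[i]^o,
  forall s s', eps (v s s') = (s == s')%:R.
Proof.
have [||eps epsE] := @gam_univ _ _ _ _ delC R[i]^o (fun _ => 1) erefl.
- by move=> *; rewrite mulr1.
- by move=> *; rewrite star1.
exists eps => s s'.
have [b [i ->]] := block_index e_bij s; have [c [j ->]] := block_index e_bij s'.
have [bc|bc] := pselect (b = c); last first.
  by rewrite (blocks_off vx) // rmorph0; case: eqP => // /e_block - /(_ bc).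
case: c / bc j => j; rewrite (blocks_diag vx) /label_proj starhom_fproj epsE.
by rewrite (fproj1 (zeta_prim R (n0 _))) dvdz_sub_ord (inj_eq (@e_inj b)).
Qed.

(** The antipode sends [x] to its adjoint, and the Fourier matrix of [star x] is
    the transpose of that of [x]. *)
Lemma blocks_antipode : exists S : {linear H -> H},
  [/\ S 1 = 1 /\ (forall a b : H, S (a * b) = S b * S a),
      forall a, S (star a) = star (S a),
      forall a, cnorm (S a) <= cnorm a &
      forall s s', S (v s s') = v s' s].
Proof.
have [|a b|a|f fE] := @gam_univ _ _ _ _ delC (opposite H) (fun g => del g^-1%g).
- by rewrite invg1 (gam1 delC).
- by rewrite invgM (gamM delC).
- exact: (gam_star delC).
have Slin : linear (fun a => f a : H) by move=> c a b; exact: (linearP f c a b).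
pose S : {linear H -> H} := HB.pack (fun a => f a : H) (GRing.isLinear.Build _ _ _ _ _ Slin).
exists S; split.
- by split=> [|a b] /=; [exact: (rmorph1 f) | exact: (rmorphM f)].
- exact: (starhom_star f).
- exact: (starhom_contr f).
move=> s s' /=.
have [b [i ->]] := block_index e_bij s; have [c [j ->]] := block_index e_bij s'.
have [bc|bc] := pselect (b = c); last first.
  by rewrite (blocks_off vx) // (blocks_off vx) ?rmorph0 //; apply: nesym.
case: c / bc j => j; rewrite !(blocks_diag vx) /label_proj starhom_fproj.
rewrite opposite_fproj fE -(gam_star delC) fproj_star ?opprB //.
  exact: free_generator_order.
exact: xU.
Qed.

Lemma blocks_embedding : embedding v.
Proof.
split; [|exact: blocks_generate| |exact: blocks_counit|exact: blocks_antipode].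
- exact: (magic_blocks n0 e_bij free_generator_order vx).
- apply: (comult_blocks n0 e_bij free_generator_order vx) => p; exact: delH.2.
Qed.

End DualOfFreeProduct.

(** * Complex matrices as a C*-algebra *)

Section HermitianNorm.
Variables (R : realType) (n : nat).
Implicit Types u v : 'rV[R[i]]_n.

Definition vnorm u : R := complex.Re (sqrtC (dotmx u u)).

Lemma vnormE u : (vnorm u)%:C = sqrtC (dotmx u u).
Proof. by rewrite /vnorm RRe_real // ger0_real // sqrtC_ge0 dnorm_ge0. Qed.

Lemma vnorm_ge0 u : 0 <= vnorm u.
Proof. by rewrite -lecR vnormE sqrtC_ge0 dnorm_ge0. Qed.

Lemma vnorm_sqr u : (vnorm u ^+ 2)%:C = dotmx u u.
Proof. by rewrite rmorphXn /= vnormE sqrtCK. Qed.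

Lemma vnorm_eq0 u : vnorm u = 0 -> u = 0.
Proof.
move=> u0; apply/eqP; rewrite -(dnorm_eq0 (@dotmx R[i] n)); apply/eqP.
by have := vnorm_sqr u; rewrite u0 expr0n.
Qed.

Lemma vnorm0 : vnorm 0 = 0.
Proof. by rewrite /vnorm linear0l sqrtC0. Qed.

Lemma vnormD u v : vnorm (u + v) <= vnorm u + vnorm v.
Proof.
have [tri _] := triangle_lerif (@dotmx R[i] n) u v.
suff add a b c (x y z : R[i]) : a%:C = x -> b%:C = y -> c%:C = z -> x <= y + z -> a <= b + c.
  exact: (add _ _ _ _ _ _ (vnormE (u + v)) (vnormE u) (vnormE v) tri).
by move=> <- <- <-; rewrite -(rmorphD (@real_complex R)) lecR.
Qed.

Lemma vnormZ a u : vnorm (a *: u) = Normc.normc a * vnorm u.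
Proof.
apply: complexI; rewrite rmorphM /= !vnormE dnormZ sqrtCM ?nnegrE ?dnorm_ge0 ?exprn_ge0 //.
by rewrite sqrCK.
Qed.

Lemma vnorm_CauchySchwarz u v : Normc.normc (dotmx u v) <= vnorm u * vnorm v.
Proof.
have [cs _] := CauchySchwarz_sqrt (@dotmx R[i] n) u v.
suff mul a b c (x y z : R[i]) : a%:C = x -> b%:C = y -> c%:C = z -> x <= y * z -> a <= b * c.
  exact: (mul _ _ _ _ _ _ (erefl _) (vnormE u) (vnormE v) cs).
by move=> <- <- <-; rewrite -(rmorphM (@real_complex R)) lecR.
Qed.

Lemma vnorm_sum I (s : seq I) (P : pred I) (F : I -> 'rV[R[i]]_n) :
  vnorm (\sum_(i <- s | P i) F i) <= \sum_(i <- s | P i) vnorm (F i).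
Proof.
elim/big_rec2: _ => [|i y1 y2 _ IH]; first by rewrite vnorm0.
by apply: le_trans (vnormD _ _) _; rewrite lerD2l.
Qed.

Lemma vnorm_delta i : vnorm (delta_mx 0 i) = 1.
Proof.
apply: complexI; rewrite vnormE.
suff -> : dotmx (delta_mx 0 i) (delta_mx 0 i) = 1 :> R[i] by rewrite sqrtC1.
rewrite dotmxE !mxE (bigD1 i) //= !mxE !eqxx conjC1 mulr1 big1 ?addr0 // => j ji.
by rewrite !mxE (negbTE ji) mul0r.
Qed.

Lemma vnorm_coord u i : Normc.normc (u 0 i) <= vnorm u.
Proof.
have -> : u 0 i = dotmx u (delta_mx 0 i).
  rewrite dotmxE !mxE (bigD1 i) //= !mxE !eqxx conjC1 mulr1 big1 ?addr0 // => j ji.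
  by rewrite !mxE (negbTE ji) conjC0 mulr0.
by apply: le_trans (vnorm_CauchySchwarz _ _) _; rewrite vnorm_delta mulr1.
Qed.

Lemma vnorm_le_sum u : vnorm u <= \sum_i Normc.normc (u 0 i).
Proof.
rewrite {1}[u]row_sum_delta; apply: le_trans (vnorm_sum _ _ _) _.
by apply: ler_sum => i _; rewrite vnormZ vnorm_delta mulr1.
Qed.

End HermitianNorm.

Section MatrixCStar.
Variables (R : realType) (n : nat).
Local Notation M := 'M[R[i]]_n.+1.
Implicit Types (A B : M) (u : 'rV[R[i]]_n.+1).

(** Matrices act on row vectors, so [A * B] is [A] followed by [B]. *)
Definition opnorm A : R := sup [set vnorm (u *m A) | u in [set u | vnorm u <= 1]].

Definition adjoint A : M := (map_mx Num.conj A)^T.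

Let rows_bound A u : vnorm u <= 1 -> vnorm (u *m A) <= \sum_i vnorm (row i A).
Proof.
move=> u1; rewrite mulmx_sum_row; apply: le_trans (vnorm_sum _ _ _) _.
apply: ler_sum => i _; rewrite vnormZ ler_piMl ?vnorm_ge0 //.
exact: le_trans (vnorm_coord _ _) u1.
Qed.

Lemma opnorm_ub A u : vnorm u <= 1 -> vnorm (u *m A) <= opnorm A.
Proof.
move=> u1; apply: ub_le_sup; last by exists u.
by exists (\sum_i vnorm (row i A)) => _ [w w1 <-]; exact: rows_bound.
Qed.

Lemma opnorm_le A c : (forall u, vnorm u <= 1 -> vnorm (u *m A) <= c) -> opnorm A <= c.
Proof.
move=> h; apply: ge_sup; last by move=> _ [u u1 <-]; exact: h.
by exists (vnorm (0 *m A)), 0; rewrite //= vnorm0.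
Qed.

Lemma opnorm_ge0 A : 0 <= opnorm A.
Proof.
apply: le_trans (opnorm_ub A (_ : vnorm 0 <= 1)); first exact: vnorm_ge0.
by rewrite vnorm0.
Qed.

Lemma opnorm_bound A u : vnorm (u *m A) <= opnorm A * vnorm u.
Proof.
have [u0|] := eqVneq (vnorm u) 0.
  by rewrite u0 (vnorm_eq0 u0) mul0mx vnorm0 mulr0.
move=> u0; have {}u0 : 0 < vnorm u by rewrite lt_def u0 vnorm_ge0.
rewrite -ler_pdivrMr // mulrC.
have nc : Normc.normc ((vnorm u)^-1)%:C = (vnorm u)^-1.
  by rewrite /= expr0n addr0 sqrtr_sqr ger0_norm // invr_ge0 ltW.
rewrite -[X in X * _]nc -vnormZ scalemxAl; apply: opnorm_ub.
by rewrite vnormZ nc mulVf // gt_eqF.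
Qed.

Lemma opnormD A B : opnorm (A + B) <= opnorm A + opnorm B.
Proof.
apply: opnorm_le => u u1; rewrite mulmxDr; apply: le_trans (vnormD _ _) _.
by apply: lerD; exact: opnorm_ub.
Qed.

Lemma opnorm_eq0 A : opnorm A = 0 -> A = 0.
Proof.
move=> A0; apply/row_matrixP => i; rewrite row0 rowE; apply: vnorm_eq0.
apply/eqP; rewrite eq_le vnorm_ge0 andbT -A0; apply: opnorm_ub.
by rewrite vnorm_delta.
Qed.

Lemma opnormZ a A : opnorm (a *: A) = Normc.normc a * opnorm A.
Proof.
have le b B : opnorm (b *: B) <= Normc.normc b * opnorm B.
  apply: opnorm_le => u u1; rewrite -scalemxAr vnormZ ler_wpM2l ?opnorm_ub //.
  by case: (b) => ? ?; exact: sqrtr_ge0.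
apply/eqP; rewrite eq_le le /=; have [->|a0] := eqVneq a 0.
  by rewrite Normc.normc0 mul0r opnorm_ge0.
have na0 : 0 < Normc.normc a.
  rewrite lt_def; apply/andP; split; first by apply: contra a0 => /eqP/Normc.eq0_normc/eqP.
  by case: (a) => ? ?; exact: sqrtr_ge0.
rewrite -[X in _ * opnorm X](scalerK a0) -ler_pdivlMl //.
apply: le_trans (le _ _) _; rewrite ler_wpM2r ?opnorm_ge0 //.
rewrite le_eqVlt; apply/orP; left; apply/eqP; apply: (mulfI (lt0r_neq0 na0)).
by rewrite -Normc.normcM [RHS]mulfV ?lt0r_neq0 // mulfV // Normc.normc1.
Qed.

Lemma opnormM A B : opnorm (A *m B) <= opnorm A * opnorm B.
Proof.
apply: opnorm_le => u u1; rewrite mulmxA.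
have AB := opnorm_bound B (u *m A).
have uA : opnorm B * vnorm (u *m A) <= opnorm B * opnorm A.
  by apply: ler_wpM2l; [exact: opnorm_ge0 | exact: opnorm_ub].
by rewrite [leRHS]mulrC; exact: (le_trans AB uA).
Qed.

Lemma adjointK : involutive adjoint.
Proof. by move=> A; apply/matrixP => i j; rewrite !mxE conjCK. Qed.

Lemma adjointD A B : adjoint (A + B) = adjoint A + adjoint B.
Proof. by apply/matrixP => i j; rewrite !mxE rmorphD. Qed.

Lemma adjointZ (a : R[i]) A : adjoint (a *: A) = a^* *: adjoint A.
Proof. by apply/matrixP => i j; rewrite !mxE rmorphM. Qed.

Lemma adjointM A B : adjoint (A *m B) = adjoint B *m adjoint A.
Proof. by rewrite /adjoint map_mxM trmx_mul. Qed.

Lemma dotmx_adjoint A u v : dotmx (u *m A) v = dotmx u (v *m adjoint A).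
Proof.
rewrite !dotmxE -mulmxA; congr ((_ *m _) 0 0).
apply/matrixP=> i j; rewrite !mxE rmorph_sum; apply: eq_bigr => k _.
by rewrite !mxE rmorphM /= conjCK mulrC.
Qed.

(** With [B] the adjoint of [A] and [u] in the unit ball, Cauchy-Schwarz gives
    [|u A|^2 = (u, u A B) <= |u A B|]. *)
Let opnorm_adjoint_ge A : opnorm A ^+ 2 <= opnorm (A *m adjoint A).
Proof.
rewrite -(@ler_sqrt _ (_ ^+ 2)) ?opnorm_ge0 // sqrtr_sqr ger0_norm ?opnorm_ge0 //.
apply: opnorm_le => u u1; rewrite -[leLHS]ger0_norm ?vnorm_ge0 // -sqrtr_sqr.
rewrite ler_sqrt ?opnorm_ge0 // -lecR vnorm_sqr dotmx_adjoint -mulmxA.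
apply: le_trans (_ : (vnorm u * vnorm (u *m (A *m adjoint A)))%:C <= _); last first.
  rewrite lecR; apply: le_trans (opnorm_ub _ u1).
  by rewrite ler_piMl ?vnorm_ge0.
apply: le_trans (_ : `|dotmx u (u *m (A *m adjoint A))| <= _).
  rewrite ger0_norm //; rewrite mulmxA -dotmx_adjoint.
  by rewrite -vnorm_sqr lecR sqr_ge0.
by rewrite lecR vnorm_CauchySchwarz.
Qed.

Let le_of_sqr (a b : R) : 0 <= a -> 0 <= b -> a ^+ 2 <= a * b -> a <= b.
Proof.
rewrite le_eqVlt => /orP[/eqP <- //|a0] _.
by rewrite expr2 ler_pM2l.
Qed.

Lemma opnorm_adjoint A : opnorm (adjoint A) = opnorm A.
Proof.
have le B : opnorm B <= opnorm (adjoint B).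
  apply: le_of_sqr (opnorm_ge0 B) (opnorm_ge0 (adjoint B)) _.
  exact: (le_trans (opnorm_adjoint_ge B) (opnormM B (adjoint B))).
apply: le_anti; apply/andP; split; last exact: (le A).
by have := le (adjoint A); rewrite (adjointK A).
Qed.

Lemma opnorm_starM A : opnorm (adjoint A *m A) = opnorm A ^+ 2.
Proof.
apply: le_anti; apply/andP; split.
  by have := opnormM (adjoint A) A; rewrite (opnorm_adjoint A) -expr2.
by have := opnorm_adjoint_ge (adjoint A); rewrite (adjointK A) (opnorm_adjoint A).
Qed.

(** The operator norm lies between each entry and the sum of all of them, so
    convergence is entrywise. *)
Lemma opnorm_complete (w : nat -> M) :
  (forall e : R, 0 < e -> exists n0, forall m n, (n0 <= m)%N -> (n0 <= n)%N ->
     opnorm (w m - w n) < e) ->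
  exists l : M, forall e : R, 0 < e -> exists n0, forall n, (n0 <= n)%N ->
     opnorm (w n - l) < e.
Proof.
move=> cw.
have entry A i j : Normc.normc (A i j) <= opnorm A.
  have -> : A i j = (row i A) 0 j by rewrite mxE.
  apply: le_trans (vnorm_coord _ _) _; rewrite rowE; apply: opnorm_ub.
  by rewrite vnorm_delta.
have lim i : exists l : R[i], forall e : R, 0 < e -> exists n0, forall m,
    (n0 <= m)%N -> Normc.normc (w m i.1 i.2 - l) < e.
  apply: (@cnorm_complete R R[i]^o) => e e0; have [n0 wn0] := cw e e0.
  exists n0 => m m' mn mn'; apply: le_lt_trans (wn0 m m' mn mn').
  by have := entry (w m - w m') i.1 i.2; rewrite !mxE.
have [l {}lim] := choice lim.
exists (\matrix_(i, j) l (i, j)) => e e0.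
(* The denominator exceeds the number of entries, which keeps the bound strict. *)
pose e' := e / (n.+1 * n.+1).+1%:R.
have e'0 : 0 < e' by rewrite divr_gt0.
have [n0 {}lim] := choice (fun i => lim i e' e'0).
exists (\max_i n0 i) => m mn.
apply: (@le_lt_trans _ _ (\sum_(i < n.+1) \sum_(j < n.+1) e')); last first.
  rewrite !sumr_const !card_ord -mulrnA -mulr_natr /e' mulrAC.
  by rewrite ltr_pdivrMr // ltr_pM2l // ltr_nat.
apply: opnorm_le => u /rows_bound/le_trans; apply.
apply: ler_sum => i _; apply: le_trans (vnorm_le_sum _) _.
apply: ler_sum => j _; rewrite !mxE; apply/ltW/(lim (i, j)).
by apply: leq_trans mn; exact: leq_bigmax.
Qed.

HB.instance Definition _ := @isCStarAlgebra.Build R M adjoint opnorm adjointK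
  adjointD adjointZ adjointM opnorm_eq0 opnormD opnormZ opnormM opnorm_starM
  opnorm_complete.

End MatrixCStar.

(** * Complex reflections and two lines in the plane *)

Section ProjectionSymmetries.
Variables (K : fieldType) (n : nat) (z : K) (A : algType K) (q : A).
Hypotheses (zP : n.-primitive_root z) (qq : q * q = q).

(** The element with eigenvalue [z] on the range of [q] and [1] on its kernel. *)
Definition creflection : A := 1 - q + z *: q.

Lemma creflectionX m : creflection ^+ m = 1 - q + z ^+ m *: q.
Proof.
have q1 : (1 - q) * q = 0 by rewrite mulrBl mul1r qq subrr.
have q2 : q * (1 - q) = 0 by rewrite mulrBr mulr1 qq subrr.
have q3 : (1 - q) * (1 - q) = 1 - q by rewrite mulrBr mulr1 q1 subr0.
elim: m => [|m IHm]; first by rewrite !expr0 scale1r subrK.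
rewrite exprS IHm /creflection; move: (1 - q) q1 q2 q3 => p q1 q2 q3.
rewrite mulrDl !mulrDr q3 -!scalerAr -!scalerAl q1 q2 qq.
by rewrite !scaler0 addr0 add0r scalerA -exprSr.
Qed.

Lemma creflection_order : creflection ^+ n = 1.
Proof. by rewrite creflectionX (prim_expr_order zP) scale1r subrK. Qed.

(** For [n = 1] the eigenvalues [1] and [z] coincide and the projection would be
    [1]. *)
Lemma fproj_creflection : (1 < n)%N -> fproj n z creflection (-1) = q.
Proof.
move=> n1; rewrite /fproj.
under eq_bigr => m _.
  rewrite creflectionX scalerDr scalerA exprnP mulN1r -expfzDr ?(prim_root_neq0 zP) //.
  rewrite addNr expr0z scale1r -mulN1r.
  over.
rewrite big_split /= -scaler_suml (character_sum zP) dvdzE /= dvdn1 gtn_eqF // muln0.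
rewrite scale0r add0r sumr_const_nat subn1 -scaler_nat scalerA mulVf ?scale1r //.
exact: prim_root_natf_neq0 zP.
Qed.

End ProjectionSymmetries.

Lemma creflection_unitary (R : realType) (A : cstarType R) n (q : A) :
  (0 < n)%N -> q * q = q -> star q = q ->
  star (creflection (zeta R n) q) * creflection (zeta R n) q = 1.
Proof.
move=> n0 qq qs; set x := creflection _ _.
have xn := creflection_order (zeta_prim R n0) qq : x ^+ n = 1.
suff -> : star x = x ^+ n.-1 by rewrite -exprSr prednK.
rewrite creflectionX // /x /creflection !starD starZ qs -[- q]scaleN1r starZ qs star1 rmorphN1.
congr (_ + _ *: _); rewrite conj_zeta; apply/esym.
apply: (mulfI (prim_root_neq0 (zeta_prim R n0))).
rewrite -exprS prednK // (prim_expr_order (zeta_prim R n0)) mulfV //.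
exact: prim_root_neq0 (zeta_prim R n0).
Qed.

Section TwoProjections.
Variable R : realType.

(** The orthogonal projection onto the line at angle [t] with the first axis,
    where [c = cos t ^+ 2]; so [line_proj 1] projects onto the first axis. *)
Definition line_proj (c : R) : 'M[R[i]]_2 :=
  \matrix_(i, j) (if i == j then (if i == 0 then c else 1 - c)
                  else Num.sqrt (c * (1 - c)))%:C.

Lemma line_proj_idem c : 0 <= c <= 1 -> line_proj c * line_proj c = line_proj c.
Proof.
case/andP=> c0 c1; have s2 : Num.sqrt (c * (1 - c)) ^+ 2 = c * (1 - c).
  by rewrite sqr_sqrtr // mulr_ge0 // subr_ge0.
apply/matrixP => i j; rewrite !mxE !big_ord_recl big_ord0 !mxE addr0.
move: s2; set s := Num.sqrt _ => s2.
case: i => -[|[|//]] ?; case: j => -[|[|//]] ?; apply/eqP; rewrite eq_complex /=;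
  apply/andP; split; apply/eqP; nra.
Qed.

Lemma line_proj_star c : star (line_proj c : 'M[R[i]]_2) = line_proj c.
Proof.
apply/matrixP => i j; rewrite !mxE -[Num.conj _]/(conjc _) conjc_real.
by rewrite eq_sym; case: eqP => // ->.
Qed.

(** The cosine squared of the angle between the two lines is an invariant of the
    pair of projections, and it varies over an interval. *)
Lemma line_proj_compress c :
  line_proj 1 * line_proj c * line_proj 1 = c%:C *: line_proj 1.
Proof.
apply/matrixP => i j; rewrite !mxE !big_ord_recl big_ord0 !mxE !big_ord_recl !big_ord0 !mxE.
rewrite subrr mulr0 sqrtr0.
case: i => -[|[|//]] ?; case: j => -[|[|//]] ?; apply/eqP; rewrite eq_complex /=;
  apply/andP; split; apply/eqP; ring.
Qed.

End TwoProjections.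

(** * Generated subalgebras, ideals and finite spans *)

Section CStarSubsets.
Variables (R : realType) (A : cstarType R).

Definition commutant (T : set A) : set A := [set x | forall t, T t -> x * t = t * x].

Lemma commutant_subalg (T : set A) :
  (forall t, T t -> T (star t)) -> cstar_subalg (commutant T).
Proof.
move=> Tstar; split=> [x clx t Tt||x y Cx Cy t Tt|a x Cx t Tt|x y Cx Cy t Tt|x Cx t Tt].
- apply/eqP; rewrite -subr_eq0; apply/eqP; apply: cnorm_small0 => eps e0.
  have d0 : 0 < cnorm t *+ 2 + 1 by rewrite ltr_wpDl // mulrn_wge0 // cnorm_ge0.
  have [y Cy xy] := clx _ (divr_gt0 e0 d0).
  have -> : x * t - t * x = (x - y) * t - t * (x - y).
    by rewrite mulrBl mulrBr (Cy t Tt) opprB addrA subrK.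
  apply: (le_lt_trans (cnormD _ _)); rewrite cnormN.
  apply: (@le_lt_trans _ _ (cnorm (x - y) * (cnorm t *+ 2))).
    rewrite mulr2n [leRHS]mulrDr; apply: lerD; first exact: cnormM.
    by rewrite [leRHS]mulrC; exact: cnormM.
  apply: (@le_lt_trans _ _ (cnorm (x - y) * (cnorm t *+ 2 + 1))).
    by rewrite ler_wpM2l ?cnorm_ge0 // lerDl.
  by rewrite -ltr_pdivlMr.
- by move=> t Tt; rewrite mul1r mulr1.
- by rewrite mulrDl mulrDr Cx // Cy.
- by rewrite -scalerAl -scalerAr Cx.
- by rewrite -mulrA Cy // !mulrA Cx.
- by have := Cx _ (Tstar t Tt) => /(congr1 star); rewrite !starM starK.
Qed.

(** A double commutant argument: the commutant of [T] contains [T], so it is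
    everything; then [T] lies in the centre, so the centre is everything. *)
Lemma generated_commutative (T : set A) :
  (forall t, T t -> T (star t)) -> cstar_generated T ->
  (forall s t, T s -> T t -> s * t = t * s) -> forall x y : A, x * y = y * x.
Proof.
move=> Tstar Tgen Tcomm.
have CT : commutant T = setT.
  by apply: Tgen; [exact: commutant_subalg | move=> s Ts t Tt; exact: Tcomm].
have CA : commutant setT = setT.
  apply: Tgen; first exact: commutant_subalg.
  move=> s Ts x _; have : commutant T x by rewrite CT.
  by move=> /(_ s Ts).
move=> x y; have : commutant setT x by rewrite CA.
exact.
Qed.

Lemma starhom_closed (B : cstarType R) (f : starhom A B) (S : set B) :
  cclosed S -> cclosed [set x | S (f x)].
Proof.
move=> Sc x clx; apply: Sc => eps e0; have [y Sy xy] := clx eps e0.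
exists (f y) => //; rewrite -rmorphB.
exact: le_lt_trans (starhom_contr f _) xy.
Qed.

Lemma starhom_ker_ideal (B : cstarType R) (f : starhom A B) :
  closed_ideal [set x | f x = 0].
Proof.
split=> [|/=|x y /= fx fy|a x /= fx|x a /= fx].
- apply: (@starhom_closed _ f [set 0]) => x clx; apply: cnorm_small0 => eps e0.
  by have [_ -> ] := clx eps e0; rewrite subr0.
- exact: rmorph0.
- by rewrite rmorphD /= fx fy addr0.
- by rewrite rmorphM /= fx mulr0.
- by rewrite rmorphM /= fx mul0r.
Qed.

End CStarSubsets.

Lemma starhom_generated (R : realType) (A B : cstarType R) (f : starhom A B) (T : set A) :
  (forall y, exists x, f x = y) -> cstar_generated T -> cstar_generated (f @` T).
Proof.
move=> fsurj Tgen S Salg TS.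
have preT : [set x | S (f x)] = setT.
  apply: Tgen; last by move=> x Tx; apply: TS; exists x.
  split=> [||x y|a x|x y|x] /=.
  - exact: (starhom_closed (subalg_cclosed Salg)).
  - by rewrite rmorph1; exact: (subalg1 Salg).
  - by rewrite rmorphD; exact: (subalgD Salg).
  - by rewrite linearZ; exact: (subalgZ Salg).
  - by rewrite rmorphM; exact: (subalgM Salg).
  - by rewrite starhom_star; exact: (subalg_star Salg).
apply/seteqP; split=> // y _; have [x <-] := fsurj y.
by have : [set x | S (f x)] x by rewrite preT.
Qed.

Lemma map_adjacency (R : realType) (A B : cstarType R) (f : starhom A B) N (X : graph N) :
  map_mx f (adjacency A X) = adjacency B X.
Proof. by apply/matrixP => i j; rewrite !mxE rmorph_nat. Qed.

Lemma annihilating_combination (K : fieldType) D (C : 'M[K]_(D.+1, D)) :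
  exists2 v : 'rV[K]_D.+1, v != 0 & v *m C = 0.
Proof.
have : kermx C != 0.
  rewrite -mxrank_eq0 mxrank_ker subn_eq0 -ltnNge.
  exact: leq_ltn_trans (rank_leq_col C) _.
by case/rowV0Pn => v; rewrite sub_kermx => /eqP vC v0; exists v.
Qed.

Section FiniteGroup.
Variables (R : realType) (Gamma : groupType) (A : cstarType R) (gam : Gamma -> A).
Hypothesis gamA : full_group_cstar gam.
Variable s : seq Gamma.
Hypothesis sP : forall g, g \in s.

(** The span of the image of [Gamma], with coordinates indexed by the positions
    of an enumeration, so that dimension arguments reduce to matrices. *)
Definition gspan : set A :=
  [set x | exists c : 'I_(size s) -> R[i], x = \sum_i c i *: gam (tnth (in_tuple s) i)].

Lemma gspan0 : gspan 0.
Proof. by exists (fun=> 0); rewrite big1 // => i _; rewrite scale0r. Qed.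

Lemma gspanD x y : gspan x -> gspan y -> gspan (x + y).
Proof.
move=> [c ->] [d ->]; exists (fun i => c i + d i).
by rewrite -big_split; apply: eq_bigr => i _; rewrite scalerDl.
Qed.

Lemma gspanZ a x : gspan x -> gspan (a *: x).
Proof.
move=> [c ->]; exists (fun i => a * c i).
by rewrite scaler_sumr; apply: eq_bigr => i _; rewrite scalerA.
Qed.

Lemma gspan_sum I (r : seq I) (P : pred I) (F : I -> A) :
  (forall i, P i -> gspan (F i)) -> gspan (\sum_(i <- r | P i) F i).
Proof. by move=> h; apply: big_ind => //; [exact: gspan0 | exact: gspanD]. Qed.

Lemma gspan_gam g : gspan (gam g).
Proof.
have /tnthP[i ->] : g \in in_tuple s by exact: sP.
exists (fun j => (j == i)%:R); rewrite (bigD1 i) //= eqxx scale1r big1 ?addr0 // => j ji.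
by rewrite (negbTE ji) scale0r.
Qed.

Lemma gspanM x y : gspan x -> gspan y -> gspan (x * y).
Proof.
move=> [c ->] [d ->]; rewrite mulr_suml; apply: gspan_sum => i _.
rewrite mulr_sumr; apply: gspan_sum => j _.
rewrite -scalerAl -scalerAr -(gamM gamA).
by do 2!apply: gspanZ; exact: gspan_gam.
Qed.

Lemma gspan_fproj n z g a : gspan (fproj n z (gam g) a).
Proof.
apply: gspanZ; apply: gspan_sum => m _; apply: gspanZ.
by rewrite -(gamX gamA); exact: gspan_gam.
Qed.

(** The powers start at [y ^+ 1]: the unit would contribute outside the corner in
    which the powers are evaluated later. *)
Lemma gspan_powers_dependent y : gspan y ->
  exists2 v : 'rV[R[i]]_(size s).+1, v != 0 & \sum_i v 0 i *: y ^+ i.+1 = 0.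
Proof.
move=> ys; have pow (i : 'I_(size s).+1) : gspan (y ^+ i.+1).
  elim: (nat_of_ord i) => [|m IHm]; first by rewrite expr1.
  by rewrite exprS; exact: gspanM.
have [c cP] := choice pow.
have [v v0 vC] := annihilating_combination (\matrix_(i, j) c i j).
exists v => //; under eq_bigr => i _ do rewrite cP scaler_sumr.
rewrite exchange_big big1 //= => j _.
under eq_bigr => i _ do rewrite scalerA.
rewrite -scaler_suml; have /rowP/(_ j) := vC; rewrite !mxE => vCj.
rewrite (_ : \sum_i _ = 0) ?scale0r // -[RHS]vCj.
by apply: eq_bigr => i _; rewrite mxE.
Qed.

End FiniteGroup.

(** A polynomial of degree at most [D] with the [D + 1] roots
    [1, 1/2, ..., 1/(D + 1)] vanishes. *)
Lemma coefficients_of_vanishing_powers (R : realType) D (v : 'rV[R[i]]_D.+1) :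
  (forall c : R, 0 < c <= 1 -> \sum_i v 0 i * c%:C ^+ i.+1 = 0) -> v = 0.
Proof.
move=> vc; pose p := \poly_(i < D.+1) v 0 (inord i).
suff p0 : p = 0.
  apply/rowP => i; rewrite mxE; have := coef_poly D.+1 (fun i => v 0 (inord i)) i.
  by rewrite -/p p0 coef0 ltn_ord inord_val.
apply/eqP/negPn/negP => pn0.
pose rs := [seq ((j.+1%:R : R)^-1)%:C | j <- iota 0 D.+1].
have rsu : uniq rs.
  rewrite map_inj_uniq ?iota_uniq // => a b /complexI/invr_inj/eqP.
  by rewrite eqr_nat => /eqP[].
have rsr : all (root p) rs.
  apply/allP => _ /mapP[j _ ->]; rewrite rootE horner_poly.
  set c := (j.+1%:R)^-1; have c0 : c%:C != 0 :> R[i].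
    by apply/eqP => /complexI/eqP; rewrite invr_eq0 pnatr_eq0.
  apply/eqP/(mulfI c0); rewrite mulr0.
  have c1 : 0 < c <= 1 by rewrite invr_gt0 ltr0n /= invf_le1 ?ltr0n // ler1n.
  rewrite -[RHS](vc c c1) mulr_sumr; apply: eq_bigr => i _.
  by rewrite inord_val exprS mulrCA.
have := max_poly_roots pn0 rsr rsu; rewrite size_map size_iota ltnNge.
by rewrite size_poly.
Qed.

(** * Quantum automorphism groups with Fourier blocks *)

Lemma labelled_blocks (R : realType) (Gamma : groupType) (A : cstarType R)
    (gam : Gamma -> A) (N k r : nat) (n : 'I_k -> nat) (lab : 'I_r -> 'I_k)
    (e : forall b, 'I_(n (lab b)) -> 'I_N) (g : 'I_k -> Gamma) (u : 'M[A]_N) :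
  full_group_cstar gam ->
  (forall b i j, u (e b i) (e b j) = fourier_magic gam (g (lab b)) (n (lab b)) i j) ->
  (forall b c i j, b <> c -> u (e b i) (e c j) = 0) ->
  fourier_blocks e (gam \o g) u.
Proof.
move=> gamA ud uo; split=> [b i j|]; last exact: uo.
by rewrite ud (fourier_magicE gamA).
Qed.

Section QuantumAutomorphisms.
Variables (R : realType) (Gamma : groupType) (G : cqg R) (gam : Gamma -> G).
Hypothesis gamA : full_group_cstar gam.
Hypothesis tot : total_dual gam.
Variables (N : nat) (X : graph N) (Q : cqg R) (w : 'M[Q]_N) (phi : starhom Q G).
Hypotheses (phi_bij : bijective phi).
Variables (S : cstarType R) (u : 'M[S]_N) (q : starhom S Q).
Hypotheses (uS : universal_magic u) (q_surj : forall y, exists x, q x = y).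
Hypothesis q_ker : forall x, q x = 0 <->
  closed_ideal_gen (entries (adjacency S X *m u - u *m adjacency S X)) x.
Hypothesis wq : w = map_mx q u.

Let U := map_mx phi w.

Lemma quantum_aut_entry i j : U i j = phi (q (u i j)).
Proof. by rewrite /U wq !mxE. Qed.

Lemma quantum_aut_commute : adjacency G X *m U = U *m adjacency G X.
Proof.
rewrite /U wq -!(map_adjacency phi) -!(map_adjacency q) -!map_mxM.
congr (map_mx phi _); apply/eqP; rewrite -subr_eq0 -map_mxB; apply/eqP/matrixP => i j.
rewrite mxE [RHS]mxE; apply/q_ker => I _ sub; apply: sub.
by exists i, j.
Qed.

Lemma quantum_aut_generated : cstar_generated (entries U).
Proof.
have -> : entries U = (fun x => phi (q x)) @` entries u.
  apply/seteqP; split=> [_ [i [j ->]]|_ [_ [i [j ->]] <-]].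
    by rewrite quantum_aut_entry; exists (u i j) => //; exists i, j.
  by exists i, j; rewrite quantum_aut_entry.
have [_ ugen _] := uS.
have -> : (fun x => phi (q x)) @` entries u = phi @` (q @` entries u).
  by rewrite -image_comp.
apply: starhom_generated; last exact: starhom_generated.
by have [psi _ phipsi] := phi_bij; move=> y; exists (psi y).
Qed.

Lemma quantum_aut_selfadjoint i j : star (U i j) = U i j.
Proof.
have [um _ _] := uS.
by rewrite quantum_aut_entry -!starhom_star (magic_star um).
Qed.

(** If the image of [u] under [f] commutes with the adjacency matrix, then [f]
    kills the ideal which is the kernel of [q], so [f] factors through [Q]. *)
Lemma quantum_aut_transfer (B : cstarType R) (f : starhom S B) x :
  adjacency B X *m map_mx f u = map_mx f u *m adjacency B X ->
  phi (q x) = 0 -> f x = 0.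
Proof.
move=> fcomm phx; have /q_ker : q x = 0.
  by apply: (bij_inj phi_bij); rewrite phx rmorph0.
move=> /(_ [set x | f x = 0] (starhom_ker_ideal f)); apply.
move=> _ [i [j ->]]; rewrite /= -[LHS]/(f _).
transitivity (map_mx f (adjacency S X *m u - u *m adjacency S X) i j).
  by rewrite [RHS]mxE.
by rewrite map_mxB !map_mxM map_adjacency fcomm subrr mxE.
Qed.

Variables (k r : nat) (g : 'I_k -> Gamma) (n : 'I_k -> nat) (lab : 'I_r -> 'I_k).
Hypotheses (gn : forall p, has_order (g p) (n p))
  (ineq : forall p q, p <> q -> ~ fourier_equiv gam (g p) (g q)).
Variable e : forall b, 'I_(n (lab b)) -> 'I_N.
Hypothesis e_bij : bijective (fun s : {b : 'I_r & 'I_(n (lab b))} => e (tagged s)).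
Hypothesis Ug : fourier_blocks e (gam \o g) U.

Let n0 p : (0 < n p)%N. Proof. by case: (gn p). Qed.

(** Let [a], [a'] be an entry next to the diagonal in a block with the first and
    the second label, and [y = a a' a].  As [Gamma] is finite, [y] satisfies a fixed
    polynomial equation without constant term.  For each [c] in the unit interval,
    the complex reflections along two lines of the plane with squared cosine [c]
    have the orders required by the labels, so by totality they give a
    representation on the plane in which [y] is [c] times a fixed projection.  Then
    every such [c] is a root of the polynomial. *)
Lemma two_blocks_infinite b d (s : seq Gamma) :
  (forall h, h \in s) -> (1 < n (lab b))%N -> (1 < n (lab d))%N ->
  lab b <> lab d -> False.
Proof.
move=> sP nb nd bd.
(* Row 0 and column 1 of a block: the index difference [-1] is the one for which
   [fproj_creflection] recovers the projection of a reflection. *)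
pose entry c (nc : (1 < n (lab c))%N) := u (e (Ordinal (n0 (lab c)))) (e (Ordinal nc)).
pose y := entry b nb * entry d nd * entry b nb.
have Gentry c nc : phi (q (entry c nc)) = label_proj n (gam \o g) (lab c) (-1).
  by rewrite -quantum_aut_entry (blocks_diag Ug).
have yspan : gspan gam s (phi (q y)).
  rewrite !rmorphM /= !Gentry.
  by do !apply: (gspanM gamA sP); exact: gspan_fproj.
have [v v0 vy] := gspan_powers_dependent gamA sP yspan.
case/eqP: v0; apply: coefficients_of_vanishing_powers => c /andP[c0 c1].
have c01 : 0 <= c <= 1 by rewrite ltW.
pose B := 'M[R[i]]_2 : cstarType R.
have P01 : 0 <= (1 : R) <= 1 by rewrite ler01 lexx.
pose x p : B := if p == lab b then creflection (zeta R (n p)) (line_proj 1)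
  else if p == lab d then creflection (zeta R (n p)) (line_proj c) else 1.
have xn p : x p ^+ n p = 1.
  rewrite /x; case: ifP => _.
    exact: creflection_order (zeta_prim R (n0 p)) (line_proj_idem P01).
  case: ifP => _; first exact: creflection_order (zeta_prim R (n0 p)) (line_proj_idem c01).
  by rewrite expr1n.
have xU p : star (x p) * x p = 1.
  rewrite /x; case: ifP => _.
    exact: creflection_unitary (n0 p) (line_proj_idem P01) (line_proj_star 1).
  case: ifP => _; last by rewrite star1 mulr1.
  exact: creflection_unitary (n0 p) (line_proj_idem c01) (line_proj_star c).
have [m mx] := fourier_blocks_exists e_bij x.
have mm : magic m := magic_blocks n0 e_bij xn mx xU.
have [f fu] : exists f : starhom S B, forall i j, f (u i j) = m i j.
  by have [_ _ univ] := uS; exact: univ mm.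
have mf : map_mx f u = m by apply/matrixP => i j; rewrite mxE.
have fcomm : adjacency B X *m map_mx f u = map_mx f u *m adjacency B X.
  rewrite mf; apply: (blocks_commute_transfer gamA tot gn ineq e_bij xn Ug mx).
  exact: quantum_aut_commute.
have fb : f (entry b nb) = line_proj 1.
  rewrite fu (blocks_diag mx) /label_proj /x eqxx.
  exact: fproj_creflection (zeta_prim R (n0 _)) (line_proj_idem P01) nb.
have fd : f (entry d nd) = line_proj c.
  rewrite fu (blocks_diag mx) /label_proj /x eqxx; case: eqP => [/esym //|_].
  exact: fproj_creflection (zeta_prim R (n0 _)) (line_proj_idem c01) nd.
have fy : f y = c%:C *: line_proj 1.
  by rewrite !rmorphM /= fb fd; exact: line_proj_compress.
have : f (\sum_i v 0 i *: y ^+ i.+1) = 0.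
  apply: (quantum_aut_transfer fcomm).
  rewrite !linear_sum -[RHS]vy; apply: eq_bigr => i _.
  by rewrite !linearZ !rmorphXn.
rewrite linear_sum.
have PX i : f y ^+ i.+1 = c%:C ^+ i.+1 *: line_proj 1.
  rewrite fy; elim: i => [|i IHi]; first by rewrite !expr1.
  by rewrite exprS IHi -scalerAl -scalerAr scalerA -exprS line_proj_idem.
have term i : f (v 0 i *: y ^+ i.+1) = (v 0 i * c%:C ^+ i.+1) *: line_proj 1.
  transitivity (v 0 i *: f (y ^+ i.+1)); first exact: linearZ.
  by rewrite rmorphXn PX scalerA.
rewrite (eq_bigr _ (fun i _ => term i)).
rewrite -scaler_suml => /matrixP/(_ 0 0).
by rewrite !mxE /= mulr1.
Qed.

(** The entries of the fundamental matrix are polynomials in the labels and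
    generate the algebra, in which distinct group elements stay distinct. *)
Lemma commuting_labels_abelian :
  (forall p q, gam (g p) * gam (g q) = gam (g q) * gam (g p)) -> group_abelian Gamma.
Proof.
move=> gcomm h1 h2.
have Gcomm : forall a a' : G, a * a' = a' * a.
  apply: (generated_commutative (T := entries U)).
  - by move=> _ [i [j ->]]; exists i, j; rewrite quantum_aut_selfadjoint.
  - exact: quantum_aut_generated.
  move=> _ _ [i [j ->]] [i' [j' ->]].
  have Uproj s t : U s t = 0 \/ exists p a, U s t = label_proj n (gam \o g) p a.
    have [b [i1 ->]] := block_index e_bij s; have [c [j1 ->]] := block_index e_bij t.
    have [bc|bc] := pselect (b = c); last by left; exact: (blocks_off Ug).
    by case: c / bc j1 => j1; right; rewrite (blocks_diag Ug); eexists; eexists.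
  have [->|[p [a ->]]] := Uproj i j; first by rewrite mul0r mulr0.
  have [->|[p' [a' ->]]] := Uproj i' j'; first by rewrite mul0r mulr0.
  by apply: fproj_comm; exact: gcomm.
apply/eqP/negPn/negP => /eqP h12.
pose h (i : 'I_2) := if i == 0 then (h1 * h2)%g else (h2 * h1)%g.
have hinj : injective h.
  move=> i j; rewrite /h; case: i => -[|[|//]] ?; case: j => -[|[|//]] ? /= E.
  - exact: val_inj.
  - by case: h12.
  - by case: h12.
  - exact: val_inj.
have := gam_free gamA hinj (c := fun i => if i == 0 then 1 else -1).
rewrite !big_ord_recl big_ord0 /= /h /= scale1r scaleN1r addr0.
rewrite !(gamM gamA) (Gcomm (gam h1)) subrr => /(_ erefl 0) /=.
by move/eqP; rewrite oner_eq0.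
Qed.

End QuantumAutomorphisms.

Theorem proposition8p1 (R : realType) :
  (forall (Gamma : groupType) (G : cqg R) (gam : Gamma -> G),
     group_dual gam -> ~ group_abelian Gamma -> total_dual gam ->
   forall (N : nat) (X : graph N) (u : 'M[G]_N), acts X u ->
   forall (k : nat) (g : 'I_k -> Gamma) (n : 'I_k -> nat),
     fourier_labelling gam u g n ->
   forall (F : groupType)
     (iota : forall p : 'I_k, {multiplicative cyclic_grp (n p) -> F}),
     free_product iota ->
   forall (H : cqg R) (del : F -> H), group_dual del ->
   exists v : 'M[H]_N, acts X v)
  /\
  (forall (Gamma : groupType) (G : cqg R) (gam : Gamma -> G),
     group_dual gam -> finite_set [set: Gamma]%classic ->
     ~ group_abelian Gamma -> total_dual gam ->
   ~ frucht (fun N (u : 'M[G]_N) => fourier_type gam u)).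
Proof.
split=> [Gamma G gam [gamA _] _ tot N X u [_ du] k g n|Gamma G gam [gamA _] fin nab tot].
  move=> [gn [ineq [r [lab [e [lab_surj e_bij ud uo]]]]]] F iota Ffree H del delH.
  have ug := labelled_blocks gamA ud uo.
  have n0 p : (0 < n p)%N by case: (gn p).
  pose x p := del (iota p (cyclic_gen (n p))).
  have [v vx] := fourier_blocks_exists e_bij x.
  exists v; split; first exact: (blocks_embedding n0 lab_surj e_bij Ffree delH vx).
  apply: (blocks_commute_transfer gamA tot gn ineq e_bij _ ug vx du).
  exact: (free_generator_order n0 iota delH).
move=> [N [X [Q [w [phi [[S [u [q [uS qsurj qker wq _]]]] [phi_bij _] [k [g [n]]]]]]]]].
move=> [gn [ineq [r [lab [e [lab_surj e_bij ud uo]]]]]].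
have Ug := labelled_blocks gamA ud uo.
apply: nab; apply: (commuting_labels_abelian gamA phi_bij uS qsurj wq e_bij Ug) => p p'.
have [->//|pp'] := eqVneq p p'.
have /finite_seqP[s sP] := fin.
have sA h : h \in s by have : [set: Gamma]%classic h by []; rewrite sP.
have trivial_label p1 : (n p1 <= 1)%N -> gam (g p1) = 1.
  move=> n1; have [n0 gp _] := gn p1.
  have n1E : n p1 = 1%N by apply/eqP; rewrite eqn_leq n1.
  by move: gp; rewrite n1E expg1 => ->; exact: gam1.
have [np|np] := leqP (n p) 1; first by rewrite trivial_label // mul1r mulr1.
have [np'|np'] := leqP (n p') 1; first by rewrite (trivial_label p') // mul1r mulr1.
have [b bp] := lab_surj p; have [d dp] := lab_surj p'.
exfalso; apply: (two_blocks_infinite gamA tot phi_bij uS qker wq gn ineq e_bij Ug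
  (b := b) (d := d) sA); rewrite ?bp ?dp //.
exact/eqP.
Qed.
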